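(* Let $n\ge 7$ and $k\in\{1,2,3,n-1\}$ be integers and let $G\in\mathscr{Q}(n,k)$ with $G\not\cong Q_{n,k}$ and $G\not\cong Q'_{n,k}$. Then: (a) if $k\in\{1,3,n-1\}$, then $SO(G)\le\phi''(n,k)$, with equality if and only if $G\cong Q''_{n,k}$; (b) if $k=2$, then $SO(G)\le \phi^*(n,2)$, with equality if and only if $G\cong Q^*_{n,2}$.
   Context: All graphs are finite, simple and undirected; $d_G(v)$ is the degree of $v$ in $G$, and an $i$-vertex is a vertex of degree $i$. The Sombor index is $SO(G)=\sum_{uv\in E(G)}\sqrt{d_G(u)^2+d_G(v)^2}$. A connected graph $G$ is a quasi-tree if there is $u\in V(G)$ such that $G-u$ is a tree. $\mathscr{Q}(n,k)$ is the set of quasi-tree graphs $G$ of order $n$ having a vertex $u$ such that $G-u$ is a tree and $d_G(u)=k$. ''Attaching an isolated vertex to'' certain vertices means adding a new vertex and joining it by an edge to each of those vertices. Graphs: $S_m\cong K_{1,m-1}$ is the star of order $m$. $S'_n$ is obtained from $S_{n-1}$ by attaching an isolated vertex to one leaf. $S''_n$ is obtained from $S'_{n-1}$ by attaching an isolated vertex to the $2$-vertex of $S'_{n-1}$. $Q_{n,k}$ is obtained from $S_{n-1}$ and a new vertex $v$ by joining $v$ to the center of $S_{n-1}$ and to $k-1$ leaves of $S_{n-1}$. $Q^*_{n,k}$ ($1\le k\le n-2$) is obtained from $S_{n-1}$ and a new vertex $v$ by joining $v$ to $k$ leaves of $S_{n-1}$ (and not to the center). $Q'_{n,1}\cong S'_n$;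 $Q'_{n,2}$ is obtained from $Q_{n-1,2}$ by attaching an isolated vertex to one $2$-vertex of $Q_{n-1,2}$; for $3\le k\le n-1$, $Q'_{n,k}$ is obtained from $Q_{n-1,k-1}$ by attaching an isolated vertex to one $2$-vertex and to the $(k-1)$-vertex $v$ (the vertex added to the star in the construction of $Q_{n-1,k-1}$). $Q''_{n,1}\cong S''_n$; $Q''_{n,3}$ is obtained from $Q_{n-1,3}$ by attaching an isolated vertex to one $2$-vertex of $Q_{n-1,3}$; $Q''_{n,n-1}$ is obtained from $Q'_{n-1,n-2}$ by attaching an isolated vertex to one $3$-vertex and to the $(n-2)$-vertex of $Q'_{n-1,n-2}$. Functions: $\phi''(n,1)=(n-4)\sqrt{(n-3)^2+1}+\sqrt{(n-3)^2+9}+2\sqrt{10}$; $\phi''(n,3)=(n-5)\sqrt{(n-2)^2+1}+\sqrt{(n-2)^2+4}+2\sqrt{(n-2)^2+9}+\sqrt{10}+\sqrt{13}+\sqrt{18}$; $\phi''(n,n-1)=(n-3)\sqrt{(n-1)^2+4}+\sqrt{(n-1)^2+16}+\sqrt{(n-1)^2+(n-3)^2}+\sqrt{(n-3)^2+16}+(n-5)\sqrt{(n-3)^2+4}+2\sqrt{20}$; $\phi^*(n,2)=2\left(\sqrt8+\sqrt{(n-2)^2+4}\right)+(n-4)\sqrt{(n-2)^2+1}$. *)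

(* Defs.v *)
From HB Require Import structures.
From mathcomp Require Import all_boot all_order all_algebra.
From mathcomp Require Import reals.

Set Implicit Arguments.
Unset Strict Implicit.
Unset Printing Implicit Defensive.

Import Order.TTheory GRing.Theory Num.Theory.

Record sgraph := SGraph {
  vertex :> finType;
  adj : rel vertex;
  adj_sym : symmetric adj;
  adj_irr : irreflexive adj }.

Definition iso (G H : sgraph) : Prop :=
  exists f : G -> H, bijective f /\ forall x y, adj (f x) (f y) = adj x y.

Definition deg (G : sgraph) (v : G) : nat := #|[set w | adj v w]|.

Definition edges (G : sgraph) : {set {set G}} :=
  [set [set x; y] | x in [set: G], y in [set: G] & adj x y].

Definition SO (R : realType) (G : sgraph) : R :=
  (\sum_(e in edges G) Num.sqrt (\sum_(v in e) (deg v)%:R ^+ 2))%R.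

Definition connected (G : sgraph) : Prop :=
  0 < #|G| /\ forall x y : G, connect (@adj G) x y.

(* For the path library a single edge is also a cycle, of size 2. *)
Definition acyclic (G : sgraph) : Prop :=
  forall c : seq G, ucycle (@adj G) c -> size c <= 2.

Definition tree (G : sgraph) : Prop := connected G /\ acyclic G.

Section DeleteVertex.
Variables (G : sgraph) (u : G).
Let V := {x : G | x != u}.
Let e : rel V := fun x y => adj (val x) (val y).

Fact del_sym : symmetric e.
Proof. by move=> x y; exact: adj_sym. Qed.

Fact del_irr : irreflexive e.
Proof. by move=> x; exact: adj_irr. Qed.

Definition del_vertex : sgraph := SGraph del_sym del_irr.
End DeleteVertex.

Definition quasi_tree (G : sgraph) : Prop :=
  connected G /\ exists u : G, tree (del_vertex u).

Definition QT (n k : nat) (G : sgraph) : Prop :=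
  [/\ quasi_tree G, #|G| = n &
      exists u : G, tree (del_vertex u) /\ deg u = k].

(* Add a new vertex [None], adjacent exactly to the vertices of [A]. *)
Section Attach.
Variables (G : sgraph) (A : {set G}).
Let e : rel (option G) := fun x y =>
  match x, y with
  | Some x, Some y => adj x y
  | Some x, None | None, Some x => x \in A
  | None, None => false
  end.

Fact attach_sym : symmetric e.
Proof. by move=> [x|] [y|] //=; exact: adj_sym. Qed.

Fact attach_irr : irreflexive e.
Proof. by move=> [x|] //=; exact: adj_irr. Qed.

Definition attach : sgraph := SGraph attach_sym attach_irr.
End Attach.

Section Star.
Variable m : nat.
Let e : rel 'I_m := fun x y => (val x == 0) != (val y == 0).

Fact star_sym : symmetric e.
Proof. by move=> x y; rewrite /e eq_sym. Qed.

Fact star_irr : irreflexive e.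
Proof. by move=> x; rewrite /e eqxx. Qed.

Definition star : sgraph := SGraph star_sym star_irr.
End Star.

Definition center (m : nat) : {set star m} :=
  [set x : star m | nat_of_ord x == 0].

(* [leaves m j] consists of j leaves of the star (if j < m).  The leaves of a
   star are interchangeable, so taking the first j of them is no restriction. *)
Definition leaves (m j : nat) : {set star m} :=
  [set x : star m | 0 < nat_of_ord x <= j].

Definition S' (n : nat) : sgraph := attach (leaves n.-1 1).

Definition S'' (n : nat) : sgraph := attach [set x : S' n.-1 | deg x == 2].

Definition Q (n k : nat) : sgraph :=
  attach (center n.-1 :|: leaves n.-1 k.-1).

Definition Qstar (n k : nat) : sgraph := attach (leaves n.-1 k).

(* In [Q n.-1 j] with 2 <= j the first leaf of the star is a 2-vertex; it is
   [Some] of that leaf, and [None] is the vertex v added to the star.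
   Any other 2-vertex allowed by the construction gives an isomorphic graph. *)
Definition two_vertex (n j : nat) : {set Q n.-1 j} :=
  [set Some x | x in leaves n.-2 1].

Definition Q' (n k : nat) : sgraph :=
  match k with
  | 1 => S' n
  | 2 => attach (two_vertex n 2)
  | _ => attach (G := Q n.-1 k.-1) (None |: two_vertex n k.-1)
  end.

(* Only meaningful for k = 1, 3 and n.-1, the default case being k = n.-1. *)
Definition Q'' (n k : nat) : sgraph :=
  match k with
  | 1 => S'' n
  | 3 => attach (two_vertex n 3)
  | _ => attach [set x : Q' n.-1 n.-2 | (deg x == 3) || (deg x == n.-2)]
  end.

Local Open Scope ring_scope.

(* Only meaningful for k = 1, 3 and n.-1, the default case being k = n.-1. *)
Definition phi'' (R : realType) (n k : nat) : R :=
  let N : R := n%:R in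
  match k with
  | 1%N => (N - 4) * Num.sqrt ((N - 3) ^+ 2 + 1) + Num.sqrt ((N - 3) ^+ 2 + 9)
           + 2 * Num.sqrt 10
  | 3%N => (N - 5) * Num.sqrt ((N - 2) ^+ 2 + 1) + Num.sqrt ((N - 2) ^+ 2 + 4)
           + 2 * Num.sqrt ((N - 2) ^+ 2 + 9)
           + Num.sqrt 10 + Num.sqrt 13 + Num.sqrt 18
  | _ => (N - 3) * Num.sqrt ((N - 1) ^+ 2 + 4) + Num.sqrt ((N - 1) ^+ 2 + 16)
         + Num.sqrt ((N - 1) ^+ 2 + (N - 3) ^+ 2)
         + Num.sqrt ((N - 3) ^+ 2 + 16)
         + (N - 5) * Num.sqrt ((N - 3) ^+ 2 + 4) + 2 * Num.sqrt 20
  end.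

Definition phi_star2 (R : realType) (n : nat) : R :=
  let N : R := n%:R in
  2 * (Num.sqrt 8 + Num.sqrt ((N - 2) ^+ 2 + 4))
  + (N - 4) * Num.sqrt ((N - 2) ^+ 2 + 1).

(* Main.v *)
Require Import Defs.
From Stdlib Require Import NArith.
From mathcomp Require Import all_boot all_order all_algebra.
From mathcomp Require Import reals.
From mathcomp Require Import zify ring lra.

(** Write [hyp a b] for the square root of a^2 + b^2.  Acyclicity of [G - u] is
    used only through the bound [2 (n - 2 + k)] on the sum of the degrees of [G];
    hence a graph in which sufficiently many edges have been exhibited has no
    other edges and is determined up to isomorphism.  If some vertex has degree
    close to n this pins down [G] among a handful of graphs consisting of few
    special vertices and a class of interchangeable ones, whose Sombor indices
    are compared using the convexity of [hyp a].  In the remaining case all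
    degrees are small.  An estimate [hyp a b <= q a + q b] turns the Sombor
    index into a sum over the vertices of [d * q d], d being the degree: for
    large n it is bounded by the largest possible sum of squared degrees, and
    for small n by enumerating the possible degree sequences.  For k = n - 1
    every vertex is adjacent to [u], and the same argument is applied to
    [G - u]. *)

Set Implicit Arguments.
Unset Strict Implicit.
Unset Printing Implicit Defensive.

Import Order.TTheory GRing.Theory Num.Theory.

(** * Graphs with a class of interchangeable vertices *)

(** The difficulty is that the margins are small. The extremal graph has a centre of degree n - 3
    for k = 1, n - 2 for k = 2 and 3, and, inside G - u, n - 4 for k = n - 1. A vertex of at least
    this degree has at most two non-neighbours, and the rivals among the graphs with such a vertex
    lose only a bounded amount; so they have to be known exactly. Naming a few vertices and lumping
    the rest together describes each of them for all n at once, and every comparison is a single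
    inequality with n as a parameter. If no vertex reaches that degree, the quadratic terms of the
    estimate and of the extremal index still agree, and the gain is linear in n with a small
    coefficient (about 1.7 for k at most 3). The constants therefore decide where it becomes
    positive: the estimate is used from n - 7 = 5, 9, 17 and 12 on for k = 1, 2, 3 and n - 1, and
    the finitely many smaller n are left to a certified computation. *)

Lemma deg_sum (G : sgraph) (x : G) : deg x = \sum_y adj x y.
Proof. by rewrite /deg cardsE -sum1_card big_mkcond. Qed.

(** The sum of squares is taken in [nat], so that a rational bound on [hyp] becomes an inequality
    between integers. *)
Definition hyp (R : realType) (a b : nat) : R := Num.sqrt (a ^ 2 + b ^ 2)%:R.

Lemma hypC R a b : hyp R a b = hyp R b a.
Proof. by rewrite /hyp addnC. Qed.

Lemma hyp_ge0 R a b : (0 <= hyp R a b)%R.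
Proof. exact: sqrtr_ge0. Qed.

(** Each edge arises from exactly two ordered pairs. Working with ordered pairs avoids orienting the
    edges; hence the factor 2 here and in the later estimates. *)
Lemma SO_double (R : realType) (G : sgraph) :
  (SO R G *+ 2 = \sum_(x : G) \sum_(y : G) hyp R (deg x) (deg y) *+ adj x y)%R.
Proof.
rewrite pair_bigA /=.
transitivity (\sum_(p : G * G | adj p.1 p.2) hyp R (deg p.1) (deg p.2))%R;
  last first.
  by rewrite big_mkcond; apply: eq_bigr => p _; case: ifP.
rewrite (partition_big (fun p : G * G => [set p.1; p.2]) (mem (edges G))) /=;
  last first.
  by move=> [x y] /= axy; apply: imset2_f; rewrite ?inE.

rewrite /SO -sumrMnl; apply: eq_bigr => e /imset2P[x y _ /[!inE] /= axy ->].
have nxy : x != y by apply: contraTneq axy => ->; rewrite adj_irr.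
rewrite (bigD1 (x, y)) /=; last by rewrite axy eqxx.
rewrite (bigD1 (y, x)) /=; last first.
  by rewrite adj_sym axy setUC eqxx xpair_eqE negb_and eq_sym nxy.
rewrite [X in (_ + (_ + X))%R]big_pred0 ?addr0 => [|[a b]] /=; last first.
  apply/negP => /andP[/andP[/andP[aab /eqP eab] nab] nba].
  have : a \in [set x; y] by rewrite -eab !inE eqxx.
  have : b \in [set x; y] by rewrite -eab !inE eqxx orbT.
  rewrite !inE => /orP[] /eqP hb /orP[] /eqP ha; subst a b;
    by rewrite ?adj_irr ?eqxx in aab nab nba.
rewrite [hyp R (deg y) _]hypC -mulr2n /hyp big_setU1 ?inE //= big_set1.
by rewrite natrD !natrX.
Qed.

Definition edge_rel (L : seq (nat * nat)) : rel nat :=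
  fun i j => ((i, j) \in L) || ((j, i) \in L).

Definition wf_edges (L : seq (nat * nat)) (r : nat) : bool :=
  uniq L && all (fun p => p.1 < p.2 <= r) L.

(* The vertices in s are named 0, ..., r - 1 and all others are named r, so r
   stands for a class of n - r interchangeable, pairwise non-adjacent vertices. *)
Definition shape_by (L : seq (nat * nat)) (G : sgraph) (s : seq G) : Prop :=
  uniq s /\ forall x y, adj x y = edge_rel L (index x s) (index y s).

Definition shaped (L : seq (nat * nat)) (r : nat) (G : sgraph) : Prop :=
  exists2 s : seq G, size s = r & shape_by L s.

Definition mult (r n i : nat) : nat := if i == r then n - r else 1.

Definition shape_deg (L : seq (nat * nat)) (r n i : nat) : nat :=
  \sum_(p <- L) ((p.1 == i) * mult r n p.2 + (p.2 == i) * mult r n p.1).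

Definition shape_SO (R : realType) (L : seq (nat * nat)) (r n : nat) : R :=
  (\sum_(p <- L) (mult r n p.1 * mult r n p.2)%:R *
     hyp R (shape_deg L r n p.1) (shape_deg L r n p.2))%R.

(** Relies on [index x s = size s] for every [x] outside [s]: the default value of [index] is the
    name of the class, which has [#|G| - size s] members. *)
Lemma sum_index (V : nmodType) (G : finType) (s : seq G) (F : nat -> V) : uniq s ->
  (\sum_(x : G) F (index x s) =
   \sum_(i < (size s).+1) F i *+ mult (size s) #|G| i)%R.
Proof.
move=> us; rewrite (bigID (mem s)) /= big_ord_recr /= /mult eqxx; congr (_ + _)%R.
  rewrite -big_uniq //=; case: s us => [|x0 s0]; first by rewrite big_nil big_ord0.
  set s := x0 :: s0 => us; rewrite (big_nth x0) big_mkord; apply: eq_bigr => i _.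
  by rewrite index_uniq // ltn_eqF.
rewrite (eq_bigr (fun=> F (size s))) => [|x xs]; last first.
  by rewrite memNindex.
rewrite sumr_const; congr (_ *+ _)%R.
by rewrite -(cardC (mem s)) (card_uniqP us) addKn; apply: eq_card.
Qed.

Lemma sum_edge_rel (V : nmodType) (L : seq (nat * nat)) (r : nat)
    (H : nat -> nat -> V) : wf_edges L r ->
  (\sum_(i < r.+1) \sum_(j < r.+1) H i j *+ edge_rel L i j =
   \sum_(p <- L) (H p.1 p.2 + H p.2 p.1))%R.
Proof.
rewrite /wf_edges; elim: L => [_|[a b] L IH] /=.
  rewrite big_nil big1 // => i _; rewrite big1 // => j _; by rewrite mulr0n.
case/andP=> /andP[nab uL] /andP[ab aL].
rewrite big_cons -IH; last by rewrite uL aL.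
have {ab} [lab lb] := andP ab; rewrite /= in lab lb.
have lb' : b < r.+1 by [].
have la' : a < r.+1 by lia.
have nba : (b, a) \notin L.
  by apply/negP => /(allP aL) /=; lia.
pose A := Ordinal la'; pose B := Ordinal lb'.
(* The head of the list contributes its two orientations; neither recurs in the tail, whose pairs
   are increasing and differ from the head. *)
have E (i j : 'I_r.+1) : (H i j *+ edge_rel ((a, b) :: L) i j =
   (if i == A then if j == B then H i j else 0 else 0) +
   (if i == B then if j == A then H i j else 0 else 0) +
   H i j *+ edge_rel L i j)%R.
  rewrite /edge_rel !inE !xpair_eqE -!val_eqE /=.
  have [ia|ia] := eqVneq (i : nat) a; have [jb|jb] := eqVneq (j : nat) b => /=.
  - by rewrite ia jb (negPf nab) (negPf nba) (ltn_eqF lab) /= !addr0.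
  - by case: (eqVneq (i : nat) b) => ib; [lia|rewrite !add0r andbF].
  - case: (eqVneq (i : nat) b) => ib; case: (eqVneq (j : nat) a) => ja /=;
      rewrite ?add0r //; lia.
  - have [ib|ib] := eqVneq (i : nat) b; have [ja|ja] := eqVneq (j : nat) a => /=;
      rewrite ?add0r //.
    by rewrite ib ja (negPf nab) (negPf nba) /= addr0.
under eq_bigr do under eq_bigr do rewrite E.
under eq_bigr do rewrite !big_split /=.
rewrite !big_split /=; congr (_ + _ + _)%R.
  rewrite (bigD1 A) //= [X in (_ + X)%R]big1 => [|i /negPf ni];
    last by rewrite big1 // => j _; rewrite ni.
  rewrite addr0 eqxx (bigD1 B) //= eqxx big1 ?addr0 // => j /negPf nj;
    by rewrite nj.
rewrite (bigD1 B) //= [X in (_ + X)%R]big1 => [|i /negPf ni];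
  last by rewrite big1 // => j _; rewrite ni.
rewrite addr0 eqxx (bigD1 A) //= eqxx big1 ?addr0 // => j /negPf nj; by rewrite nj.
Qed.

Section ShapeTheory.
Variables (G : sgraph) (L : seq (nat * nat)) (s : seq G).
Hypotheses (wfL : wf_edges L (size s)).

Lemma shape_by_deg (x : G) : shape_by L s ->
  deg x = shape_deg L (size s) #|G| (index x s).
Proof.
case=> us H; rewrite deg_sum.
under eq_bigr do rewrite H.
set m := mult (size s) #|G|.

have -> : \sum_(y : G) edge_rel L (index x s) (index y s) =
  \sum_(j < (size s).+1) edge_rel L (index x s) j * m j.
  have := @sum_index nat G s (fun j => edge_rel L (index x s) j : nat) us.
  rewrite /= => ->; apply: eq_bigr => j _; by rewrite -mulr_natr natn.
have lx : index x s < (size s).+1 by rewrite ltnS index_size.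
(* The factor [i == index x s] cuts the double sum down to the row of [x]. *)
have := @sum_edge_rel nat L (size s) (fun i j => (i == index x s) * m j) wfL.
rewrite (bigD1 (Ordinal lx)) //= [X in (_ + X)%R]big1 => [|i ni]; last first.
  rewrite big1 // => j _; have -> : (i == index x s :> nat) = false by apply:
    negbTE; exact: ni.
  by rewrite mul0n mul0rn.
rewrite addr0 => E; refine (etrans _ E).
apply: eq_bigr => j _; rewrite eqxx mul1n.
by case: edge_rel; rewrite ?mul1n ?mul0n ?mulr1n ?mulr0n.
Qed.

Lemma shape_by_SO (R : realType) : shape_by L s ->
  SO R G = shape_SO R L (size s) #|G|.
Proof.
move=> sh; have [us H] := sh.
apply/eqP; rewrite -(eqr_pMn2r (ltn0Sn 1)) SO_double; apply/eqP.
pose m := mult (size s) #|G|.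
pose h i j := hyp R (shape_deg L (size s) #|G| i) (shape_deg L (size s) #|G| j).
pose F i j := (h i j *+ edge_rel L i j)%R.
transitivity (\sum_(x : G) \sum_(y : G) F (index x s) (index y s))%R.
  by apply: eq_bigr => x _; apply: eq_bigr => y _; rewrite /F /h -!shape_by_deg ?H.
under eq_bigr do rewrite (sum_index (F _) us).
rewrite (sum_index (fun i => \sum_(j < _) F i j *+ mult _ _ j)%R us).
pose K i j := (h i j *+ (m i * m j))%R.
transitivity (\sum_(i < (size s).+1) \sum_(j < (size s).+1) K i j *+ edge_rel L i
  j)%R.
  apply: eq_bigr => i _; rewrite -sumrMnl; apply: eq_bigr => j _.
  by rewrite /K /F -!mulrnA; congr (_ *+ _)%R; rewrite -/m; lia.
rewrite sum_edge_rel // /shape_SO -sumrMnl; apply: eq_bigr => p _.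
by rewrite /K /h -/m mulr_natl [hyp R (shape_deg _ _ _ p.2) _]hypC [m p.2 * _]mulnC
  -mulr2n.
Qed.

(** The edge list is contained in [adj]. By the first hypothesis [adj] has no more ordered pairs
    than the list, so the two relations coincide by the equality case of [leqif_sum]. *)
Lemma shape_byP : \sum_(x : G) deg x <= 2 * \sum_(p <- L) mult (size s) #|G| p.1 *
  mult (size s) #|G| p.2 ->
  uniq s ->
  (forall p, p \in L -> forall x y, index x s = p.1 -> index y s = p.2 ->
    adj x y) ->
  shape_by L s.
Proof.
move=> le us HL; split=> // x0 y0.
have sub x y : edge_rel L (index x s) (index y s) -> adj x y.
  case/orP => /HL; first exact.
  by rewrite adj_sym; apply.
have eqs : \sum_(z : G * G) edge_rel L (index z.1 s) (index z.2 s) =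
    2 * \sum_(p <- L) mult (size s) #|G| p.1 * mult (size s) #|G| p.2.
  rewrite -(pair_bigA _ (fun x y => edge_rel L (index x s) (index y s) : nat)) /=.
  pose m := mult (size s) #|G|.
  transitivity (\sum_(i < (size s).+1) \sum_(j < (size s).+1) (m i * m j) *+
    edge_rel L i j)%R.
    have S1 i : \sum_(y : G) edge_rel L i (index y s) =
        (\sum_(j < (size s).+1) edge_rel L i j * m j)%N.
      by have := @sum_index nat G s (fun j => edge_rel L i j : nat) us;
        rewrite /= => ->; apply: eq_bigr => j _; rewrite -mulr_natr natn.
    under eq_bigr do rewrite S1.
    have -> := @sum_index nat G s (fun i =>
      \sum_(j < (size s).+1) edge_rel L i j * m j) us.
    apply: eq_bigr => i _; rewrite -mulr_natr natn big_distrl; apply: eq_bigr =>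
      j _.
    change ((edge_rel L i j * m j * m i)%N = (m i * m j)%N *+ edge_rel L i j)%R.
    by case: edge_rel; rewrite /= ?mulr1n ?mulr0n ?mul1n ?mul0n // mulnC.
  have -> := @sum_edge_rel nat L (size s) (fun i j => m i * m j) wfL.
  rewrite big_distrr; apply: eq_bigr => p _.
  by change ((m p.1 * m p.2 + m p.2 * m p.1)%N = 2 * (m p.1 * m p.2)); lia.
have eqd : \sum_(x : G) deg x = \sum_(z : G * G) adj z.1 z.2.
  rewrite -(pair_bigA _ (fun x y => adj x y : nat)); apply: eq_bigr => x _.
  exact: deg_sum.
have := @leqif_sum _ predT (fun z : G * G =>
  edge_rel L (index z.1 s) (index z.2 s) == adj z.1 z.2)
  (fun z => edge_rel L (index z.1 s) (index z.2 s) : nat) (fun z =>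
    adj z.1 z.2 : nat).
case=> [[x y] _|le2 /esym E] /=.
  apply/leqifP; case: eqP => [->//|] ; have := sub x y.
  by case: edge_rel => [->|_] //; case: adj.
move: E; rewrite eqs -eqd in le2 *.
by rewrite eqn_leq le le2 => /forallP/(_ (x0, y0)) /= /eqP.
Qed.
End ShapeTheory.

(** * Shapes and isomorphism *)

Lemma iso_sym (G H : sgraph) : iso G H -> iso H G.
Proof.
case=> f [[g fK gK] fa]; exists g; split; first by exists f.
by move=> x y; rewrite -fa !gK.
Qed.

Lemma iso_shape L r (G H : sgraph) : iso G H -> shaped L r H -> shaped L r G.
Proof.
move=> /iso_sym[f [fb fa]] [s ss [us H1]]; have fi := bij_inj fb.
have [g fK gK] := fb.
exists (map f s); first by rewrite size_map.
split=> [|x y]; first by rewrite map_inj_uniq.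
by rewrite -{1}(gK x) -{1}(gK y) fa H1 -{2}(gK x) -{2}(gK y) !index_map.
Qed.

(** Complete [s] and [t] to enumerations of all vertices and match equal positions. The name of a
    vertex is its position cut off at [r], so names, and with them adjacency, are preserved. *)
Lemma shape_iso L r (G H : sgraph) : #|G| = #|H| ->
  shaped L r G -> shaped L r H -> iso G H.
Proof.
move=> GH [s ss [us sa]] [t ts [ut ta]].
pose ext (K : sgraph) (a : seq K) := a ++ [seq x <- enum K | x \notin a].
have extu (K : sgraph) (a : seq K) : uniq a -> uniq (ext K a).
  move=> ua; rewrite cat_uniq ua filter_uniq ?enum_uniq // andbT.
  by apply/hasPn => x; rewrite mem_filter => /andP[].
have extm (K : sgraph) (a : seq K) x : x \in ext K a.
  by rewrite mem_cat mem_filter mem_enum andbT orbN.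
have exts (K : sgraph) (a : seq K) : uniq a -> size (ext K a) = #|K|.
  move=> ua; rewrite -(card_uniqP (extu _ _ ua)); apply: eq_card => x.
  by rewrite extm inE.
have exti (K : sgraph) (a : seq K) x :
    index x a = minn (index x (ext K a)) (size a).
  rewrite index_cat; case: ifP => xa.
    by rewrite (minn_idPl _) // ltnW // index_mem.
  by rewrite memNindex ?xa // (minn_idPr _) // leq_addr.
have im (K : sgraph) (a : seq K) x : uniq a -> index x (ext K a) < #|K|.
  by move=> ua; rewrite -(exts _ _ ua) index_mem extm.
have f_ex x : exists y : H, index y (ext H t) == index x (ext G s).
  have lx : index x (ext G s) < size (ext H t) by rewrite exts // -GH im.
  have y0 : H by case: (ext H t) lx.
  by exists (nth y0 (ext H t) (index x (ext G s))); rewrite index_uniq // extu.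
have g_ex y : exists x : G, index x (ext G s) == index y (ext H t).
  have ly : index y (ext H t) < size (ext G s) by rewrite exts // GH im.
  have x0 : G by case: (ext G s) ly.
  by exists (nth x0 (ext G s) (index y (ext H t))); rewrite index_uniq // extu.
pose f x := xchoose (f_ex x); pose g y := xchoose (g_ex y).
have fE x : index (f x) (ext H t) = index x (ext G s) by apply/eqP/(xchooseP (f_ex
  x)).
have gE y : index (g y) (ext G s) = index y (ext H t) by apply/eqP/(xchooseP (g_ex
  y)).
exists f; split.
  exists g => [x|y].
    exact: (@index_inj _ x (ext G s) _ _ (extm _ _ _) (extm _ _ _) (etrans (gE _)
      (fE _))).
  exact: (@index_inj _ y (ext H t) _ _ (extm _ _ _) (extm _ _ _) (etrans (fE _) (gE
    _))).
by move=> x y; rewrite ta sa (exti _ t (f x)) (exti _ t (f y)) (exti _ s x) (exti _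
  s y) !fE ss ts.
Qed.

(** * Connected and acyclic graphs *)

Lemma connected_cut (G : sgraph) (X : {set G}) (a b : G) : connected G ->
  a \in X -> b \notin X -> exists x y, [/\ x \in X, y \notin X & adj x y].
Proof.
case=> _ con aX bX.
have [/existsP[x /existsP[y /and3P[xX yX xy]]]|/existsPn H] :=
    boolP [exists x : G, exists y : G, [&& x \in X, y \notin X & adj x y]].
  by exists x, y.
have cl : closed (@adj G) X.
  apply: intro_closed => [|x y xy xX].
    by apply: sym_connect_sym => x y; exact: adj_sym.
  by apply/negPn/negP => yX; move: (H x) => /existsPn/(_ y); rewrite xX yX xy.
by move: bX; rewrite -(closed_connect cl (con a b)) aX.
Qed.

Lemma connected_neighbor (G : sgraph) (x : G) : connected G -> 1 < #|G| ->
  exists y, adj x y.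
Proof.
move=> con G1.
have [y yx] : exists y, y != x.
  apply/existsP; apply: contraLR G1 => /existsPn H; rewrite -leqNgt.
  rewrite -(card1 x); apply: subset_leq_card; apply/subsetP => y _.
  by rewrite inE; apply/negPn.
have [||z [w [/set1P-> _ ?]]] := @connected_cut G [set x] x y con;
  rewrite ?inE ?eqxx //.
by exists w.
Qed.

Lemma connected_deg_gt0 (G : sgraph) (x : G) : connected G -> 1 < #|G| -> 0 < deg x.
Proof.
move=> con G1; have [y xy] := connected_neighbor x con G1.
by rewrite /deg card_gt0; apply/set0Pn; exists y; rewrite inE.
Qed.

(** Inside [X] a vertex has at most [#|X|.-1] neighbours, and the edges leaving [X] are counted
    again by the degrees outside [X]. This later discards impossible degree sequences. *)
Lemma sum_deg_subset (G : sgraph) (X : {set G}) :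
  2 * \sum_(x in X) deg x <= #|X| * #|X|.-1 + \sum_(x : G) deg x.
Proof.
rewrite mul2n -addnn [\sum_(x : G) _](bigID (mem X)) /= addnCA leq_add2l.
under eq_bigr do rewrite deg_sum (bigID (mem X)) /=.
rewrite big_split /= leq_add //.
  rewrite -sum_nat_const; apply: leq_sum => x xX.
  rewrite -big_mkcondr sum1_card (cardD1 x X) xX add1n /=.
  apply: subset_leq_card; apply/subsetP => y; rewrite !inE => /andP[-> xy].
  by rewrite andbT; apply: contraTneq xy => ->; rewrite adj_irr.
rewrite exchange_big /=; apply: leq_sum => y _;
  rewrite deg_sum [leqRHS](bigID (mem X)) /=.
by apply: leq_trans (leq_addr _ _); apply: leq_sum => x _; rewrite adj_sym.
Qed.

(** * Deleting a vertex *)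

Section Delete.
Variables (G : sgraph) (u : G).

Lemma big_del (V : nmodType) (F : G -> V) :
  (\sum_(x : G) F x = F u + \sum_(x : del_vertex u) F (val x))%R.
Proof.
rewrite (bigD1 u) //=; congr (_ + _)%R.
rewrite (reindex_omap (val : del_vertex u -> G) insub) /=.
  by apply: eq_bigl => x; rewrite (valP x) valK eqxx.
by move=> x xu; rewrite insubT.
Qed.

Lemma sum_nat_del (F : G -> nat) :
  \sum_(x : G) F x = F u + \sum_(x : del_vertex u) F (val x).
Proof. exact: big_del. Qed.

Lemma card_del : #|del_vertex u| = #|G|.-1.
Proof.
by rewrite card_sig; have := cardC1 u => <-; apply: eq_card => x; rewrite !inE.
Qed.

Lemma deg_del (x : del_vertex u) : deg (val x) = adj u (val x) + deg x.
Proof.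
by rewrite !deg_sum (sum_nat_del (fun y => adj (val x) y : nat)) adj_sym.
Qed.

Lemma sum_deg_del :
  \sum_(x : G) deg x = 2 * deg u + \sum_(x : del_vertex u) deg x.
Proof.
rewrite (sum_nat_del (@deg G)) mul2n -addnn -addnA; congr (_ + _).
rewrite (eq_bigr _ (fun x _ => deg_del x)) big_split; congr (_ + _).
by rewrite deg_sum (sum_nat_del (fun y => adj u y : nat)) adj_irr.
Qed.

Lemma acyclic_del : acyclic G -> acyclic (del_vertex u).
Proof.
move=> ac c /andP[cc uc]; rewrite -(size_map val); apply: ac.
by apply/andP; rewrite cycle_map (map_inj_uniq val_inj).
Qed.
End Delete.

(* If all degrees were at least 2, any path could be extended, since a second
   neighbor of its end lying on the path would close a cycle. *)
Lemma acyclic_leaf (G : sgraph) : acyclic G -> 0 < #|G| ->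
  exists v : G, deg v <= 1.
Proof.
move=> ac G0; case: (boolP [exists v : G, deg v <= 1]) => [/existsP//|/existsPn H];
  exfalso.
have d2 (x : G) : 1 < deg x by rewrite ltnNge H.
have ext k : exists x : G, exists p : seq G, [/\ path (@adj G) x p, uniq (x :: p) &
  size p = k].
  elim: k => [|k [x [p [pp up sp]]]].
    by have /card_gt0P[x _] := G0; exists x, [::].
  suff [y xy yp] : exists2 y, adj x y & y \notin x :: p.
    by exists y, (x :: p); rewrite /= adj_sym xy pp yp /= sp; split.
  have [y1 [y2 [n1 n2 n12]]] : exists y1, exists y2, [/\ adj x y1, adj x y2 &
    y1 != y2].
    have := d2 x; rewrite /deg => /card_gt1P[y1 [y2 []]]; rewrite !inE => *.
    by exists y1, y2.
  case: p pp up sp => [|z p] pp up sp.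
    exists y1 => //; rewrite inE; apply: contraTneq n1 => ->; by rewrite adj_irr.
  have [y xy yz] : exists2 y, adj x y & y != z.
    by case: (eqVneq y1 z) => [e|]; [exists y2; rewrite // -e eq_sym|exists y1].
  exists y => //; rewrite !inE (negPf yz) /=; apply/norP; split.
    by apply: contraTneq xy => ->; rewrite adj_irr.
  apply/negP => /splitPr E; case: E pp up {sp} => p1 p2 /= /andP[xz].
  rewrite cat_path /= => /andP[pz /andP[ly _]] up.
  have uc : ucycle (@adj G) [:: x, z & rcons p1 y].
    rewrite /ucycle /= xz !rcons_path last_rcons pz ly adj_sym xy /=.
    have : uniq ((x :: z :: rcons p1 y) ++ p2) by rewrite /= cat_rcons.
    by rewrite cat_uniq => /and3P[].
  by have := ac _ uc; rewrite /= size_rcons.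
have [x [p [_ up sp]]] := ext #|G|.
by have := max_card (mem (x :: p)); rewrite (card_uniqP up) /= sp ltnn.
Qed.

Lemma acyclic_sum_deg (G : sgraph) : acyclic G -> 0 < #|G| ->
  \sum_(x : G) deg x <= 2 * #|G|.-1.
Proof.
have [m] := ubnP #|G|; elim: m G => // m IH G lt ac G0.
have [v dv] := acyclic_leaf ac G0.
rewrite (sum_deg_del v); have := card_del v.
(* A single vertex is treated apart, since deleting it leaves the empty graph. *)
have [->/= C|G1 C] := eqVneq #|G| 1.
  rewrite big_pred0 => [|x]; last by have := fintype0 x; rewrite C => /(_ erefl).
  have := deg_sum v; rewrite (sum_nat_del v (fun y => adj v y : nat)) adj_irr.
  rewrite big_pred0 => [->//|x]; by have := fintype0 x; rewrite C => /(_ erefl).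
have lt' : #|del_vertex v| < m by rewrite C; lia.
have gt' : 0 < #|del_vertex v| by rewrite C; lia.
by have := IH _ lt' (acyclic_del ac) gt'; rewrite C; lia.
Qed.

Lemma QT_facts (n k : nat) (G : sgraph) : 3 <= n -> QT n k G ->
  [/\ connected G, #|G| = n, \sum_(x : G) deg x <= 2 * (n - 2 + k) &
    exists u : G, [/\ deg u = k, connected (del_vertex u) &
      \sum_(x : del_vertex u) deg x <= 2 * (n - 2)]].
Proof.
move=> n3 [[con _] cG [u [[conT acT] du]]].
have lT : \sum_(x : del_vertex u) deg x <= 2 * (n - 2).
  have T0 : 0 < #|del_vertex u| by rewrite card_del cG; lia.
  by have := acyclic_sum_deg acT T0; rewrite card_del cG; lia.
split=> //; last by exists u.
by rewrite (sum_deg_del u) du; lia.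
Qed.

(** * The graphs of the theorem *)

(** In all these lists 0 is the centre of the star, and the final pair [(0, r)] joins it to the
    class of its remaining leaves. *)
Definition star_edges := [:: (0, 1)].
Definition S'_edges := [:: (0, 1); (1, 2); (0, 3)].
Definition S''_edges := [:: (0, 1); (1, 2); (1, 3); (0, 4)].
Definition Q2_edges := [:: (0, 1); (0, 2); (1, 2); (0, 3)].
Definition Q'2_edges := [:: (0, 1); (1, 2); (0, 3); (1, 3); (0, 4)].
Definition Qstar2_edges := [:: (0, 2); (0, 3); (1, 2); (1, 3); (0, 4)].
Definition Q3_edges := [:: (0, 1); (0, 2); (0, 3); (1, 2); (1, 3); (0, 4)].
Definition Q'3_edges := [:: (0, 1); (1, 2); (0, 3); (1, 3); (2, 3); (0, 4)].
Definition Q''3_edges := [:: (0, 1); (1, 2); (0, 3); (1, 3); (3, 4); (0, 4);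
  (0, 5)].

(* The join with a new vertex, which gets the name 0 while all old names are
   shifted by one. *)
Definition cone (L : seq (nat * nat)) (r : nat) : seq (nat * nat) :=
  [seq (0, j.+1) | j <- iota 0 r.+1] ++ [seq (p.1.+1, p.2.+1) | p <- L].

Lemma mem_two_vertex n j (x : Q n.-1 j) :
  (x \in two_vertex n j) = if x is Some i then 0 < nat_of_ord i <= 1 else false.
Proof.
apply/imsetP/idP => [[i]|]; first by rewrite inE => h ->.
by case: x => // i h; exists i; rewrite // inE.
Qed.

(** Writing the order as [m.+4.+3] makes the named ordinals and their [index] compute, so that
    adjacency is checked by a finite case split for all orders at once. The vertices are listed in
    the order of their names in the edge list. *)
Lemma shape_Q1 m : shaped star_edges 1 (Q m.+4.+3 1).
Proof.
exists [:: Some (Ordinal (isT : 0 < m.+4.+2))] => //; split=> // x y.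
case: x => [[[|x] hx]|]; case: y => [[[|y] hy]|]; rewrite /= ?inE //=.
Qed.

Lemma shape_Q2 m : shaped Q2_edges 3 (Q m.+4.+3 2).
Proof.
exists [:: Some (Ordinal (isT : 0 < m.+4.+2)); None;
  Some (Ordinal (isT : 1 < m.+4.+2))] => //; split=> // x y.
by case: x => [[[|[|x]] hx]|]; case: y => [[[|[|y]] hy]|]; rewrite /= ?inE.
Qed.

Lemma shape_Q'2 m : shaped Q'2_edges 4 (Q' m.+4.+3 2).
Proof.
exists [:: Some (Some (Ordinal (isT : 0 < m.+4.+1)));
  Some (Some (Ordinal (isT : 1 < m.+4.+1))); None; Some None] => //; split=> // x y.
by case: x => [[[[|[|x]] hx]|]|]; case: y => [[[[|[|y]] hy]|]|];
  rewrite /= ?(@mem_two_vertex m.+4.+3) ?inE.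
Qed.

Lemma shape_Qstar2 m : shaped Qstar2_edges 4 (Qstar m.+4.+3 2).
Proof.
exists [:: Some (Ordinal (isT : 0 < m.+4.+2)); None;
  Some (Ordinal (isT : 1 < m.+4.+2)); Some (Ordinal (isT : 2 < m.+4.+2))] => //;
    split=> // x y.
by case: x => [[[|[|[|x]]] hx]|]; case: y => [[[|[|[|y]]] hy]|]; rewrite /= ?inE.
Qed.

Lemma shape_Q3 m : shaped Q3_edges 4 (Q m.+4.+3 3).
Proof.
exists [:: Some (Ordinal (isT : 0 < m.+4.+2)); None;
  Some (Ordinal (isT : 1 < m.+4.+2)); Some (Ordinal (isT : 2 < m.+4.+2))] => //;
    split=> // x y.
by case: x => [[[|[|[|x]]] hx]|]; case: y => [[[|[|[|y]]] hy]|]; rewrite /= ?inE.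
Qed.

Lemma shape_Q'3 m : shaped Q'3_edges 4 (Q' m.+4.+3 3).
Proof.
exists [:: Some (Some (Ordinal (isT : 0 < m.+4.+1)));
  Some (Some (Ordinal (isT : 1 < m.+4.+1))); None; Some None] => //; split=> // x y.
by case: x => [[[[|[|x]] hx]|]|]; case: y => [[[[|[|y]] hy]|]|];
  rewrite /= ?in_setU1 ?(@mem_two_vertex m.+4.+3) ?inE.
Qed.

Lemma shape_Q''3 m : shaped Q''3_edges 5 (Q'' m.+4.+3 3).
Proof.
exists [:: Some (Some (Ordinal (isT : 0 < m.+4.+1)));
  Some (Some (Ordinal (isT : 1 < m.+4.+1))); None; Some None;
    Some (Some (Ordinal (isT : 2 < m.+4.+1)))] => //; split=> // x y.
by case: x => [[[[|[|[|x]]] hx]|]|]; case: y => [[[[|[|[|y]]] hy]|]|];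
  rewrite /= ?(@mem_two_vertex m.+4.+3) ?inE.
Qed.

Lemma shape_Q'1 m : shaped S'_edges 3 (S' m.+4.+3).
Proof.
exists [:: Some (Ordinal (isT : 0 < m.+4.+2)); Some (Ordinal (isT : 1 < m.+4.+2));
  None] => //; split=> // x y.
by case: x => [[[|[|x]] hx]|]; case: y => [[[|[|y]] hy]|]; rewrite /= ?inE.
Qed.

(** The new vertex is attached by a condition on degrees, so the shape of the smaller graph is
    established to read the degrees off it. *)
Lemma shape_Q''1 m : shaped S''_edges 4 (S'' m.+4.+3).
Proof.
pose s : seq (S' m.+4.+2) := [:: Some (Ordinal (isT : 0 < m.+4.+1));
  Some (Ordinal (isT : 1 < m.+4.+1)); None].
have sh : shape_by S'_edges s.
  split=> // x y.
  by case: x => [[[|[|x]] hx]|]; case: y => [[[|[|y]] hy]|]; rewrite /= ?inE.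
have mem2 z : (z \in [set x : S' m.+4.+2 | deg x == 2]) = (index z s == 1).
  rewrite inE (@shape_by_deg _ S'_edges s isT z sh) /shape_deg /S'_edges.
  rewrite !big_cons big_nil card_option card_ord /mult /=.
  case: z => [[[|[|z]] hz]|] /=; lia.
exists [:: Some (Some (Ordinal (isT : 0 < m.+4.+1)));
  Some (Some (Ordinal (isT : 1 < m.+4.+1))); Some None; None] => //; split=> // x y.
by case: x => [[[[|[|x]] hx]|]|]; case: y => [[[[|[|y]] hy]|]|];
  rewrite /= ?mem2 ?inE.
Qed.

Lemma shape_Qn m : shaped (cone star_edges 1) 2 (Q m.+4.+3 m.+4.+2).
Proof.
exists [:: None; Some (Ordinal (isT : 0 < m.+4.+2))] => //; split=> // x y.
case: x => [[[|x] hx]|]; case: y => [[[|y] hy]|]; rewrite /= ?inE //=; lia.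
Qed.

Lemma shape_Q'n m : shaped (cone S'_edges 3) 4 (Q' m.+4.+3 m.+4.+2).
Proof.
exists [:: Some None; Some (Some (Ordinal (isT : 0 < m.+4.+1)));
  Some (Some (Ordinal (isT : 1 < m.+4.+1))); None] => //; split=> // x y.
case: x => [[[[|[|x]] hx]|]|]; case: y => [[[[|[|y]] hy]|]|];
  rewrite /= ?in_setU1 ?(@mem_two_vertex m.+4.+3) ?inE //=; lia.
Qed.

Lemma shape_Q''n m : shaped (cone S''_edges 4) 5 (Q'' m.+4.+3 m.+4.+2).
Proof.
pose s : seq (Q' m.+4.+2 m.+4.+1) := [:: Some None;
  Some (Some (Ordinal (isT : 0 < m.+4))); Some (Some (Ordinal (isT : 1 < m.+4)));
    None].
have sh : shape_by (cone S'_edges 3) s.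
  split=> // x y.
  case: x => [[[[|[|x]] hx]|]|]; case: y => [[[[|[|y]] hy]|]|];
    rewrite /= ?in_setU1 ?(@mem_two_vertex m.+4.+2) ?inE //=; lia.
(* The names 0, 1, 2, 3 and the class have degrees m + 5, m + 4, 3, 2 and 2. *)
have mem2 z : (z \in [set x : Q' m.+4.+2 m.+4.+1 | (deg x == 3) || (deg x ==
  m.+4.+1)]) = (index z s == 0) || (index z s == 2).
  rewrite inE (@shape_by_deg _ (cone S'_edges 3) s isT z sh) /shape_deg /cone /=.
  rewrite !big_cons big_nil !card_option card_ord /mult /=.
  case: z => [[[[|[|z]] hz]|]|] /=; lia.
exists [:: Some (Some None); Some (Some (Some (Ordinal (isT : 0 < m.+4))));
  Some (Some (Some (Ordinal (isT : 1 < m.+4)))); Some None; None] => //;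
    split=> // x y.
case: x => [[[[[|[|x]] hx]|]|]|]; case: y => [[[[[|[|y]] hy]|]|]|];
  rewrite /= ?mem2 ?in_setU1 ?(@mem_two_vertex m.+4.+2) ?inE //=; lia.
Qed.

(** * Comparison of Sombor indices *)

(** The rivals. Spider (two pendant paths of length 2) and broom (one of length 3) compete for k = 1
    and, under a cone, for k = n - 1; the triangle with a tail for k = 2; the last three for k = 3.
    A house is a triangle and a 4-cycle sharing an edge, a diamond two triangles sharing an edge. *)
Definition spider_edges := [:: (0, 1); (1, 2); (0, 3); (3, 4); (0, 5)].
Definition broom_edges := [:: (0, 1); (1, 2); (2, 3); (0, 4)].
Definition triangle_tail_edges :=
  [:: (0, 1); (1, 2); (0, 3); (3, 4); (0, 4); (0, 5)].
Definition Qstar3_edges :=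
  [:: (0, 2); (0, 3); (0, 4); (1, 2); (1, 3); (1, 4); (0, 5)].
Definition house_edges :=
  [:: (0, 1); (1, 2); (0, 3); (2, 3); (3, 4); (0, 4); (0, 5)].
Definition diamond_tail_edges :=
  [:: (0, 1); (1, 2); (0, 3); (3, 4); (3, 5); (0, 4); (0, 5); (0, 6)].

(** * Rational bounds, monotonicity and convexity of [hyp] *)

Section Hyp.
Variable R : realType.
Local Open Scope ring_scope.
Implicit Types a b p q : nat.

Lemma hyp_le a b q p : (q ^ 2 * (a ^ 2 + b ^ 2) <= p ^ 2)%N ->
  q%:R * hyp R a b <= p%:R.
Proof.
move=> h; rewrite -(ler_pXn2r (n := 2)) ?nnegrE ?mulr_ge0 ?ler0n ?hyp_ge0 //.
by rewrite exprMn /hyp sqr_sqrtr ?ler0n // -!natrX -natrM ler_nat.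
Qed.

Lemma hyp_ge a b q p : (p ^ 2 <= q ^ 2 * (a ^ 2 + b ^ 2))%N ->
  p%:R <= q%:R * hyp R a b.
Proof.
move=> h; rewrite -(ler_pXn2r (n := 2)) ?nnegrE ?mulr_ge0 ?ler0n ?hyp_ge0 //.
by rewrite exprMn /hyp sqr_sqrtr ?ler0n // -!natrX -natrM ler_nat.
Qed.

Lemma hyp_mono a b a' b' : (a <= a')%N -> (b <= b')%N -> hyp R a b <= hyp R a' b'.
Proof.
by move=> h h'; rewrite /hyp ler_wsqrtr // ler_nat leq_add // leq_sqr.
Qed.

Lemma hyp_convex a b : 2 * hyp R a b.+1 <= hyp R a b + hyp R a b.+2.
Proof.
set x := hyp R a b; set y := hyp R a b.+2; set z := hyp R a b.+1.
have [x0 y0 z0] : [/\ 0 <= x, 0 <= y & 0 <= z] by split; exact: hyp_ge0.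
pose A : R := a%:R; pose B : R := b%:R.
have sqE c : hyp R a c ^+ 2 = A ^+ 2 + c%:R ^+ 2 :> R.
  by rewrite /hyp sqr_sqrtr ?ler0n // natrD !natrX.
have [xE yE zE] : [/\ x ^+ 2 = A ^+ 2 + B ^+ 2, y ^+ 2 = A ^+ 2 + (B + 2) ^+ 2
   & z ^+ 2 = A ^+ 2 + (B + 1) ^+ 2] by split; rewrite sqE ?natrD // -?natr1 /B;
     ring.
have [A0 B0] : 0 <= A /\ 0 <= B by rewrite !ler0n.
(* The Cauchy-Schwarz inequality for the vectors (A, B) and (A, B + 2). *)
have xy : A ^+ 2 + B ^+ 2 + 2 * B <= x * y.
  rewrite -(ler_pXn2r (n := 2)) ?nnegrE ?mulr_ge0 //; last by nra.
  rewrite exprMn xE yE; nra.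
rewrite -(ler_pXn2r (n := 2)) ?nnegrE ?addr_ge0 ?mulr_ge0 //.
have -> : (2 * z) ^+ 2 = 4 * z ^+ 2 by ring.
have -> : (x + y) ^+ 2 = x ^+ 2 + y ^+ 2 + 2 * (x * y) by ring.
rewrite xE yE zE; nra.
Qed.

End Hyp.

(** A triple [(c, a, b)] stands for c times [hyp a b]. Keeping the combination as data lets one list
    be evaluated over [R] in the comparisons and rounded down in the computations. *)
Definition hyp_comb (R : realType) (l : seq (nat * nat * nat)) : R :=
  foldr (fun t x => t.1.1%:R * hyp R t.1.2 t.2 + x)%R 0%R l.

Lemma hyp_comb_cons (R : realType) c c' a a' b b' l (x : R) :
  c = c' -> a = a' -> b = b' -> x = hyp_comb R l ->
  (c%:R * hyp R a b + x = hyp_comb R ((c', a', b') :: l))%R.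
Proof. by move=> -> -> -> ->. Qed.

Definition S''_comb (m : nat) :=
  [:: (1, m.+4, 3); (1, 3, 1); (1, 3, 1); (m.+3, m.+4, 1)].
Definition Qstar2_comb (m : nat) :=
  [:: (1, m.+4.+1, 2); (1, m.+4.+1, 2); (1, 2, 2); (1, 2, 2); (m.+3, m.+4.+1, 1)].
Definition Q''3_comb (m : nat) :=
  [:: (1, m.+4.+1, 3); (1, 3, 1); (1, m.+4.+1, 3); (1, 3, 3); (1, 3, 2);
    (1, m.+4.+1, 2); (m.+2, m.+4.+1, 1)].
Definition cone_S''_comb (m : nat) :=
  [:: (1, m.+4.+2, m.+4); (1, m.+4.+2, 4); (1, m.+4.+2, 2); (1, m.+4.+2, 2);
    (m.+2, m.+4.+2, 2); (1, m.+4, 4); (1, 4, 2); (1, 4, 2); (m.+2, m.+4, 2)].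

Ltac shape_SO_tac :=
  rewrite ?/S''_comb ?/Qstar2_comb ?/Q''3_comb ?/cone_S''_comb;
  rewrite /shape_SO /shape_deg ?big_cons ?big_nil /mult /=;
  rewrite ?mul1n ?mul0n ?add0n ?addn0;
  repeat (apply: hyp_comb_cons; [lia | lia | lia | ]); reflexivity.

(** * Sombor indices of the shapes, for n = m + 7 *)

Section ShapeSO.
Variables (R : realType) (m : nat).
Local Open Scope ring_scope.
Local Notation n := (m.+4.+3).
Local Notation f := (hyp R).

Lemma SO_S'' : shape_SO R S''_edges 4 n =
  hyp_comb R (S''_comb m).
Proof. shape_SO_tac. Qed.

Lemma SO_spider : shape_SO R spider_edges 5 n =
  hyp_comb R [:: (1, m.+4, 2); (1, 2, 1); (1, m.+4, 2); (1, 2, 1); (m.+2, m.+4, 1)].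
Proof. shape_SO_tac. Qed.

Lemma SO_broom : shape_SO R broom_edges 4 n =
  hyp_comb R [:: (1, m.+4, 2); (1, 2, 2); (1, 2, 1); (m.+3, m.+4, 1)].
Proof. shape_SO_tac. Qed.

Lemma SO_Qstar2 : shape_SO R Qstar2_edges 4 n =
  hyp_comb R (Qstar2_comb m).
Proof. shape_SO_tac. Qed.

Lemma SO_triangle_tail : shape_SO R triangle_tail_edges 5 n =
  hyp_comb R [:: (1, m.+4.+1, 2); (1, 2, 1); (1, m.+4.+1, 2); (1, 2, 2);
    (1, m.+4.+1, 2); (m.+2, m.+4.+1, 1)].
Proof. shape_SO_tac. Qed.

Lemma SO_Q''3 : shape_SO R Q''3_edges 5 n =
  hyp_comb R (Q''3_comb m).
Proof. shape_SO_tac. Qed.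

Lemma SO_Qstar3 : shape_SO R Qstar3_edges 5 n =
  hyp_comb R [:: (1, m.+4.+1, 2); (1, m.+4.+1, 2); (1, m.+4.+1, 2); (1, 3, 2);
    (1, 3, 2); (1, 3, 2); (m.+2, m.+4.+1, 1)].
Proof. shape_SO_tac. Qed.

Lemma SO_house : shape_SO R house_edges 5 n =
  hyp_comb R [:: (1, m.+4.+1, 2); (1, 2, 2); (1, m.+4.+1, 3); (1, 2, 3); (1, 3, 2);
    (1, m.+4.+1, 2); (m.+2, m.+4.+1, 1)].
Proof. shape_SO_tac. Qed.

Lemma SO_diamond_tail : shape_SO R diamond_tail_edges 6 n =
  hyp_comb R [:: (1, m.+4.+1, 2); (1, 2, 1); (1, m.+4.+1, 3); (1, 3, 2); (1, 3, 2);
    (1, m.+4.+1, 2); (1, m.+4.+1, 2); (m.+1, m.+4.+1, 1)].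
Proof. shape_SO_tac. Qed.

Lemma SO_cone_S'' : shape_SO R (cone S''_edges 4) 5 n =
  hyp_comb R (cone_S''_comb m).
Proof. shape_SO_tac. Qed.

Lemma SO_cone_spider : shape_SO R (cone spider_edges 5) 6 n =
  hyp_comb R [:: (1, m.+4.+2, m.+4); (1, m.+4.+2, 3); (1, m.+4.+2, 2);
    (1, m.+4.+2, 3); (1, m.+4.+2, 2); (m.+1, m.+4.+2, 2); (1, m.+4, 3); (1, 3, 2);
      (1, m.+4, 3); (1, 3, 2); (m.+1, m.+4, 2)].
Proof. shape_SO_tac. Qed.

Lemma SO_cone_broom : shape_SO R (cone broom_edges 4) 5 n =
  hyp_comb R [:: (1, m.+4.+2, m.+4); (1, m.+4.+2, 3); (1, m.+4.+2, 3);
    (1, m.+4.+2, 2); (m.+2, m.+4.+2, 2); (1, m.+4, 3); (1, 3, 3); (1, 3, 2);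
      (m.+2, m.+4, 2)].
Proof. shape_SO_tac. Qed.

Lemma sqrt_hyp (x : R) a b : x = (a ^ 2 + b ^ 2)%:R -> Num.sqrt x = f a b.
Proof. by move=> ->. Qed.

Lemma phi''_1 : phi'' R n 1 = shape_SO R S''_edges 4 n.
Proof.
rewrite SO_S'' /phi'' /hyp_comb /S''_comb /=.
rewrite (@sqrt_hyp ((n%:R - 3) ^+ 2 + 1) m.+4 1); last by rewrite natrD !natrX;
  ring.
rewrite (@sqrt_hyp ((n%:R - 3) ^+ 2 + 9) m.+4 3); last by rewrite natrD !natrX;
  ring.
rewrite (@sqrt_hyp 10 3 1) //; ring.
Qed.

Lemma phi''_3 : phi'' R n 3 = shape_SO R Q''3_edges 5 n.
Proof.
rewrite SO_Q''3 /phi'' /hyp_comb /Q''3_comb /=.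
rewrite (@sqrt_hyp ((n%:R - 2) ^+ 2 + 1) m.+4.+1 1); last by rewrite natrD !natrX;
  ring.
rewrite (@sqrt_hyp ((n%:R - 2) ^+ 2 + 4) m.+4.+1 2); last by rewrite natrD !natrX;
  ring.
rewrite (@sqrt_hyp ((n%:R - 2) ^+ 2 + 9) m.+4.+1 3); last by rewrite natrD !natrX;
  ring.
rewrite (@sqrt_hyp 10 3 1) // (@sqrt_hyp 13 3 2) // (@sqrt_hyp 18 3 3) //; ring.
Qed.

Lemma phi''_n : phi'' R n m.+4.+2 = shape_SO R (cone S''_edges 4) 5 n.
Proof.
rewrite SO_cone_S'' /phi'' /hyp_comb /cone_S''_comb /=.
rewrite (@sqrt_hyp ((n%:R - 1) ^+ 2 + 4) m.+4.+2 2); last by rewrite natrD !natrX;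
  ring.
rewrite (@sqrt_hyp ((n%:R - 1) ^+ 2 + 16) m.+4.+2 4); last by rewrite natrD !natrX;
  ring.
rewrite (@sqrt_hyp ((n%:R - 1) ^+ 2 + (n%:R - 3) ^+ 2) m.+4.+2 m.+4);
  last by rewrite natrD !natrX; ring.
rewrite (@sqrt_hyp ((n%:R - 3) ^+ 2 + 16) m.+4 4); last by rewrite natrD !natrX;
  ring.
rewrite (@sqrt_hyp ((n%:R - 3) ^+ 2 + 4) m.+4 2); last by rewrite natrD !natrX;
  ring.
rewrite (@sqrt_hyp 20 4 2) //; ring.
Qed.

Lemma phi_star2E : phi_star2 R n = shape_SO R Qstar2_edges 4 n.
Proof.
rewrite SO_Qstar2 /phi_star2 /hyp_comb /Qstar2_comb /=.
rewrite (@sqrt_hyp ((n%:R - 2) ^+ 2 + 4) m.+4.+1 2); last by rewrite natrD !natrX;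
  ring.
rewrite (@sqrt_hyp ((n%:R - 2) ^+ 2 + 1) m.+4.+1 1); last by rewrite natrD !natrX;
  ring.
rewrite (@sqrt_hyp 8 2 2) //; ring.
Qed.

Lemma hyp21_le : 10%:R * f 2 1 <= 23%:R. Proof. by apply: hyp_le; lia. Qed.
Lemma hyp22_le : 100%:R * f 2 2 <= 283%:R. Proof. by apply: hyp_le; lia. Qed.
Lemma hyp22_ge : 28%:R <= 10%:R * f 2 2. Proof. by apply: hyp_ge; lia. Qed.
Lemma hyp31_ge : 316%:R <= 100%:R * f 3 1. Proof. by apply: hyp_ge; lia. Qed.
Lemma hyp32_le : 100%:R * f 3 2 <= 361%:R. Proof. by apply: hyp_le; lia. Qed.
Lemma hyp33_ge : 424%:R <= 100%:R * f 3 3. Proof. by apply: hyp_ge; lia. Qed.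
Lemma hyp33_le : 100%:R * f 3 3 <= 425%:R. Proof. by apply: hyp_le; lia. Qed.
Lemma hyp42_ge : 447%:R <= 100%:R * f 4 2. Proof. by apply: hyp_ge; lia. Qed.

(** Moving the end of one path to the middle of the other changes the degrees 2, 2 next to the
    centre into 1, 3, which convexity rewards; the two outer edges grow from sqrt 5 to sqrt 10. *)
Lemma spider_lt : shape_SO R spider_edges 5 n < phi'' R n 1.
Proof.
rewrite phi''_1 SO_S'' SO_spider /hyp_comb /S''_comb /=.
have := hyp21_le; have := hyp31_ge; have := hyp_convex R m.+4 1; lra.
Qed.

Lemma broom_lt : shape_SO R broom_edges 4 n < phi'' R n 1.
Proof.
rewrite phi''_1 SO_S'' SO_broom /hyp_comb /S''_comb /=.
have := hyp21_le; have := hyp31_ge; have := hyp22_le.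
have := @hyp_mono R m.+4 2 m.+4 3 (leqnn _) isT; lra.
Qed.

Lemma triangle_tail_lt : shape_SO R triangle_tail_edges 5 n < phi_star2 R n.
Proof.
rewrite phi_star2E SO_Qstar2 SO_triangle_tail /hyp_comb /Qstar2_comb /=.
have := hyp21_le; have := hyp22_ge.
(* Monotonicity is adverse here: the rival has one more edge between degrees n - 2 and 2. Its gain
   must stay below the 0.5 = 2.8 - 2.3 by which an edge between degrees 2 and 2 beats one between 2
   and 1. It is less than 0.4, as the two squares differ by 3 and both roots are at least 5. *)
suff : f m.+4.+1 2 <= f m.+4.+1 1 + 4 / 10 by lra.
set x := f _ 2; set y := f _ 1.
have x0 : 0 <= x by exact: hyp_ge0.
have m0 : 0 <= m%:R :> R by [].
have y5 : 5 <= y.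
  by have := @hyp_ge R m.+4.+1 1 1 5; rewrite mul1r; apply; nia.
have xE : x ^+ 2 = y ^+ 2 + 3.
  by rewrite /x /y /hyp !sqr_sqrtr // !natrD; ring.
nra.
Qed.

Lemma Qstar3_lt : shape_SO R Qstar3_edges 5 n < phi'' R n 3.
Proof.
rewrite phi''_3 SO_Q''3 SO_Qstar3 /hyp_comb /Q''3_comb /=.
have := hyp31_ge; have := hyp32_le; have := hyp33_ge.
have := @hyp_mono R m.+4.+1 2 m.+4.+1 3 (leqnn _) isT; lra.
Qed.

Lemma house_lt : shape_SO R house_edges 5 n < phi'' R n 3.
Proof.
rewrite phi''_3 SO_Q''3 SO_house /hyp_comb /Q''3_comb /= [f 2 3]hypC.
have := hyp31_ge; have := hyp32_le; have := hyp33_ge; have := hyp22_le.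
have := @hyp_mono R m.+4.+1 2 m.+4.+1 3 (leqnn _) isT; lra.
Qed.

Lemma diamond_tail_lt : shape_SO R diamond_tail_edges 6 n < phi'' R n 3.
Proof.
rewrite phi''_3 SO_Q''3 SO_diamond_tail /hyp_comb /Q''3_comb /=.
have := hyp31_ge; have := hyp32_le; have := hyp33_ge; have := hyp21_le.
have := hyp_convex R m.+4.+1 1; lra.
Qed.

(** The same move as for the uncovered spider; convexity is used twice, for the edges to the apex
    and for those to the centre. *)
Lemma cone_spider_lt : shape_SO R (cone spider_edges 5) 6 n < phi'' R n m.+4.+2.
Proof.
rewrite phi''_n SO_cone_S'' SO_cone_spider /hyp_comb /cone_S''_comb /=.
have := hyp32_le; have := hyp42_ge.
have := hyp_convex R m.+4.+2 2; have := hyp_convex R m.+4 2; lra.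
Qed.

Lemma cone_broom_lt : shape_SO R (cone broom_edges 4) 5 n < phi'' R n m.+4.+2.
Proof.
rewrite phi''_n SO_cone_S'' SO_cone_broom /hyp_comb /cone_S''_comb /=.
have := hyp32_le; have := hyp42_ge; have := hyp33_le.
have := hyp_convex R m.+4.+2 2.
have := @hyp_mono R m.+4 3 m.+4 4 (leqnn _) isT; lra.
Qed.

End ShapeSO.

(** * Degree sequences *)

(** Each edge end at [x] is charged [q (deg x)], and [x] has [deg x] of them. [g] is general so as
    to cover degrees shifted by a cone. *)
Lemma energy_le (R : realType) (G : sgraph) (g : nat -> nat -> R) (q : nat -> R) :
  (forall x y : G, adj x y -> g (deg x) (deg y) <= q (deg x) + q (deg y))%R ->
  (\sum_(x : G) \sum_(y : G) g (deg x) (deg y) *+ adj x y <=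
   (\sum_(x : G) q (deg x) *+ deg x) *+ 2)%R.
Proof.
move=> H.
have E : (\sum_(x : G) \sum_(y : G) q (deg x) *+ adj x y = \sum_(x : G) q (deg x)
  *+ deg x)%R.
  by apply: eq_bigr => x _; rewrite sumrMnr -deg_sum.
rewrite mulr2n -{1}E -E [X in (_ <= _ + X)%R]exchange_big -big_split.
apply: ler_sum => x _; rewrite -big_split; apply: ler_sum => y _ /=.
rewrite [adj y x]adj_sym; case: (boolP (adj x y)) => [/H|_];
  first by rewrite !mulr1n.
by rewrite !mulr0n addr0.
Qed.

(** Nonincreasing sequences of positive entries. The cap [S - n'] on the head leaves at least 1 for
    each of the [n'] later entries. *)
Fixpoint deg_seqs (n S M : nat) : seq (seq nat) :=
  if n is n'.+1 then
    flatten [seq [seq d :: s | s <- deg_seqs n' (S - d) d]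
      | d <- iota 1 (minn M (S - n'))]
  else [:: [::]].

Lemma sumn_ge_size s : all (leq 1) s -> size s <= sumn s.
Proof. by elim: s => //= d s IH /andP[d1 /IH]; lia. Qed.

Lemma mem_deg_seqs s S M : sorted geq s -> all (fun d => 1 <= d <= M) s ->
  sumn s <= S -> s \in deg_seqs (size s) S M.
Proof.
elim: s S M => //= d s IH S M ss /andP[dM aM] lS.
have ls : size s <= sumn s.
  by apply: sumn_ge_size; apply: sub_all aM => e /andP[].
apply/flatten_mapP; exists d; first by rewrite mem_iota; lia.
apply: map_f; apply: IH; [exact: path_sorted ss | | lia].
have := order_path_min (rev_trans leq_trans) ss => /allP le.
by apply/allP => e es; have := le _ es; have := allP aM _ es; rewrite /=; lia.
Qed.

(* The inequalities are those of [sum_deg_subset] for the two and the three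
   largest degrees, [2 * E] being the sum of all degrees. *)
Definition plausible (E : nat) (ds s : seq nat) : bool :=
  [&& nth 0 s 0 + nth 0 s 1 <= E.+1,
      nth 0 s 0 + nth 0 s 1 + nth 0 s 2 <= E + 3 & all [in s] ds].

Lemma deg_seqP (G : sgraph) (E M : nat) (ds : seq nat) : 3 <= #|G| ->
  (forall x : G, 1 <= deg x <= M) -> \sum_(x : G) deg x <= 2 * E ->
  (forall d, d \in ds -> exists x : G, deg x = d) ->
  exists2 s, s \in deg_seqs #|G| (2 * E) M &
    plausible E ds s /\ forall (V : nmodType) (F : nat -> V),
      (\sum_(x : G) F (deg x) = \sum_(d <- s) F d)%R.
Proof.
move=> G3 dM dE Hds.
pose vs := sort (fun x y : G => deg y <= deg x) (enum G).
pose s := [seq deg x | x <- vs].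
have pv : perm_eq vs (enum G) by rewrite perm_sort.
have sv : size vs = #|G| by rewrite (perm_size pv) -cardE.
have uv : uniq vs by rewrite (perm_uniq pv) enum_uniq.
have big_s (V : nmodType) (F : nat ->
  V) : (\sum_(x : G) F (deg x) = \sum_(d <- s) F d)%R.
  by rewrite big_map (perm_big _ pv) /= big_enum.
have ins (w : G) : deg w \in s by apply: map_f; rewrite (perm_mem pv) mem_enum.
exists s; last first.
  split=> //; have [x [y [z [vs' Evs]]]] : exists x y z vs', vs = [:: x, y, z &
    vs'].
    by move: sv G3; case: (vs) => [|x [|y [|z vs']]] /= <- // _;
      exists x, y, z, vs'.
  move: uv; rewrite Evs /= !inE !negb_or => /and4P[/and3P[xy xz _] /andP[yz _] _ _].
  (* [vs] is sorted by decreasing degree, so [x], [y], [z] have the three largest degrees. *)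
  have := sum_deg_subset (x |: [set y]);
    have := sum_deg_subset (x |: (y |: [set z])).
  rewrite !big_setU1 ?big_set1 ?cardsU1 ?cards1 ?inE ?negb_or ?xy ?xz ?yz //= =>
    S3 S2.
  rewrite /plausible /s Evs /=; apply/and3P; split; [lia|lia|].
  by apply/allP => d /Hds[w <-]; have := ins w; rewrite /s Evs.
rewrite -sv -(size_map (@deg G)); apply: mem_deg_seqs.
- rewrite sorted_map; apply: sort_sorted => x y; exact: leq_total.
- by apply/allP => d /mapP[x _ ->].
- by rewrite sumnE -(@big_s nat id).
Qed.

(** * Rounded square roots in binary arithmetic, in units of 1/1000 *)

Lemma nat_of_add_bin (x y : N) : nat_of_bin (N.add x y) = x + y.
Proof. by case: x y => [|p] [|q] //=; rewrite ?addn0 // nat_of_add_pos. Qed.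

Lemma nat_of_mul_bin (x y : N) : nat_of_bin (N.mul x y) = x * y.
Proof. by case: x y => [|p] [|q] //=; rewrite ?muln0 // nat_of_mul_pos. Qed.

Lemma nat_of_bin_le (x y : N) : N.le x y -> x <= y.
Proof. by move=> h; rewrite -(N.sub_add _ _ h) nat_of_add_bin leq_addl. Qed.

Lemma nat_of_bin_lt (x y : N) : N.lt x y -> x < y.
Proof.
by move/N.le_succ_l/nat_of_bin_le; rewrite -N.add_1_l nat_of_add_bin.
Qed.

Definition scale : N := 1000%num.

Definition hyp_floor (a b : nat) : N :=
  N.sqrt (scale * scale * bin_of_nat (a ^ 2 + b ^ 2))%num.

Definition hyp_comb_floor (l : seq (nat * nat * nat)) : N :=
  foldr (fun t x => bin_of_nat t.1.1 * hyp_floor t.1.2 t.2 + x)%num 0%num l.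

(** [s] is the excess of the true degrees over the enumerated ones: 0 for G itself, 1 for G - u
    under a cone. Comparing squares keeps the test exact. *)
Definition edge_check (s : nat) (q : nat -> N) (M : nat) : bool :=
  all (fun a => all (fun b =>
    N.leb (scale * scale * bin_of_nat ((a + s) ^ 2 + (b + s) ^ 2))
          ((q a + q b) * (q a + q b))) (iota 1 M)) (iota 1 M).

Definition deg_check (q v : nat -> N) (n E M : nat) (ds : seq nat) (B : N) : bool :=
  all (fun s => plausible E ds s ==>
    N.ltb (foldr (fun d x => bin_of_nat d * q d + v d + x)%num 0%num s) B)
  (deg_seqs n (2 * E) M).

Section Small.
Variable R : realType.
Local Open Scope ring_scope.

Lemma scale_gt0 : (0 < scale)%N. Proof. exact: (@nat_of_bin_lt 0%num). Qed.

Lemma hyp_floor_le a b : (hyp_floor a b)%:R <= scale%:R * hyp R a b.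
Proof.
apply: hyp_ge; have [h _] := N.sqrt_spec (scale * scale * bin_of_nat (a ^ 2 + b ^
  2))%num (N.le_0_l _).
by move/nat_of_bin_le: h; rewrite !nat_of_mul_bin bin_of_natK !mulnn.
Qed.

Lemma hyp_floor_ge a b : scale%:R * hyp R a b <= (hyp_floor a b).+1%:R.
Proof.
apply: hyp_le; have [_ h] := N.sqrt_spec (scale * scale * bin_of_nat (a ^ 2 + b ^
  2))%num (N.le_0_l _).
move/N.lt_le_incl/nat_of_bin_le: h.
by rewrite -!N.add_1_l !nat_of_mul_bin !nat_of_add_bin bin_of_natK !mulnn.
Qed.

Lemma hyp_comb_floor_le l : (hyp_comb_floor l)%:R <= scale%:R * hyp_comb R l.
Proof.
elim: l => [|[[c a] b] l IH] /=; first by rewrite mulr0.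
rewrite nat_of_add_bin nat_of_mul_bin bin_of_natK natrD natrM mulrDr lerD //.
by rewrite mulrCA ler_wpM2l // hyp_floor_le.
Qed.

Lemma edge_checkP s q M a b : edge_check s q M -> (1 <= a <= M)%N ->
  (1 <= b <= M)%N ->
  scale%:R * hyp R (a + s) (b + s) <= (q a)%:R + (q b)%:R.
Proof.
move=> ec ha hb; have ia : a \in iota 1 M by rewrite mem_iota; lia.
have ib : b \in iota 1 M by rewrite mem_iota; lia.
have /N.leb_le/nat_of_bin_le := allP (allP ec _ ia) _ ib.
rewrite !nat_of_mul_bin !nat_of_add_bin bin_of_natK !mulnn => h.
by rewrite -natrD; apply: hyp_le.
Qed.

(** [w] carries the edges to the apex of a cone and [v] is its upper bound in thousandths; without a
    cone both are taken to be 0. *)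
Lemma small_bound (G : sgraph) (s : nat) (q v : nat -> N) (w : nat -> R)
    (E M : nat) (ds : seq nat) (l : seq (nat * nat * nat)) :
  (3 <= #|G|)%N -> (forall x : G, 1 <= deg x <= M)%N ->
  (\sum_(x : G) deg x <= 2 * E)%N ->
  (forall d, d \in ds -> exists x : G, deg x = d) ->
  (forall d, scale%:R * w d <= (v d)%:R) ->
  edge_check s q M -> deg_check q v #|G| E M ds (hyp_comb_floor l) ->
  (\sum_(x : G) w (deg x)) *+ 2 +
  \sum_(x : G) \sum_(y : G) hyp R (deg x + s) (deg y + s) *+ adj x y
    < hyp_comb R l *+ 2.
Proof.
move=> G3 dM dE Hds wv ec dc.
have [t tm [pt big_t]] := deg_seqP G3 dM dE Hds.
have /N.ltb_lt/nat_of_bin_lt := implyP (allP dc _ tm) pt.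
set A := foldr _ _ _ => ltA.
have K0 : 0 < scale%:R :> R by rewrite ltr0n scale_gt0.
rewrite -(ltr_pM2l K0) mulrDr !mulrnAr.
have eA : (A : nat)%:R = \sum_(d <- t) ((q d)%:R *+ d + (v d)%:R) :> R.
  rewrite /A; elim: (t) => [|d u IH] /=; first by rewrite big_nil.
  rewrite big_cons -IH !nat_of_add_bin nat_of_mul_bin bin_of_natK !natrD natrM.
  by rewrite mulr_natl.
have en := @energy_le R G (fun a b => scale%:R * hyp R (a + s) (b + s)) (fun a =>
  (q a)%:R).
have {}en := en (fun x y _ => edge_checkP ec (dM x) (dM y)).
rewrite !mulr_sumr.
under [X in _ + X]eq_bigr do rewrite mulr_sumr.
under [X in _ + X]eq_bigr do under eq_bigr do rewrite mulrnAr.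
apply: le_lt_trans (lerD (lexx _) en) _; rewrite -mulrnDl ltr_pMn2r //.
apply: lt_le_trans (hyp_comb_floor_le l).
apply: le_lt_trans (_ : (A : nat)%:R < _); last by rewrite ltr_nat.
rewrite eA -(big_t _ (fun d => (q d)%:R *+ d + (v d)%:R)) big_split addrC lerD2l.
by apply: ler_sum => x _.
Qed.

End Small.

(* The weights solve q a + q b >= 1000 hyp (a + s) (b + s) greedily from
   q 1 = 1070 for s = 0, and from q 1 = 1680 for s = 1. *)
Definition weight0 (d : nat) : N := nth 0%num
  [:: 0; 1070; 1415; 2191; 3058; 4030; 5013; 6002; 6993; 7986; 8980; 9976;
      10972; 11969; 12966; 13964; 14962; 15960; 16958; 17957; 18955]%num d.
Definition weight1 (d : nat) : N := nth 0%num
  [:: 0; 1680; 2122; 2878; 3709; 4645; 5601; 6567; 7540; 8519; 9501; 10486;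
      11473; 12463]%num d.

(** With n = m + 7, the bound [m + 3], and [m + 4] in the next two checks, is the largest degree
    left once a vertex of large degree is excluded. The range of [m] ends where the estimate for
    large n takes over. *)
Lemma deg_check_S'' : all (fun m => edge_check 0 weight0 (m + 3) &&
  deg_check weight0 (fun=> 0%num) (m + 7) (m + 6) (m + 3) [::]
  (hyp_comb_floor (S''_comb m))) (iota 0 5).
Proof. by vm_compute. Qed.

Lemma deg_check_Qstar2 : all (fun m => edge_check 0 weight0 (m + 4) &&
  deg_check weight0 (fun=> 0%num) (m + 7) (m + 7) (m + 4) [::]
  (hyp_comb_floor (Qstar2_comb m))) (iota 0 9).
Proof. by vm_compute. Qed.

(** The list [[:: 3]] keeps only the sequences in which the degree of u occurs. *)
Lemma deg_check_Q''3 : all (fun m => edge_check 0 weight0 (m + 4) &&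
  deg_check weight0 (fun=> 0%num) (m + 7) (m + 8) (m + 4) [:: 3]
  (hyp_comb_floor (Q''3_comb m))) (iota 0 17).
Proof. by vm_compute. Qed.

(** The sequences are those of G - u, of order m + 6, which is also the degree of the apex. The
    [+ 1] turns a rounded-down length into an upper bound. *)
Lemma deg_check_cone_S'' : all (fun m => edge_check 1 weight1 (m + 2) &&
  deg_check weight1 (fun d => hyp_floor (m + 6) d.+1 + 1)%num (m + 6) (m + 5) (m +
    2) [::]
  (hyp_comb_floor (cone_S''_comb m))) (iota 0 12).
Proof. by vm_compute. Qed.

(** * Sums of squared degrees *)

Lemma sum_sqr_le_sqr_sum (I : finType) (A : pred I) (e : I -> nat) :
  \sum_(i | A i) e i ^ 2 <= (\sum_(i | A i) e i) ^ 2.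
Proof.
rewrite [leqRHS]expnS expn1 big_distrl /=; apply: leq_sum => i Ai.
by rewrite expnS expn1 leq_mul2l (bigD1 i) //= leq_addr orbT.
Qed.

(** By convexity the extreme case is one entry [P] and one entry [r]. If one entry a is at least
    half of the sum, merge the others into T; when T exceeds [r], shifting the excess from T to a
    increases a^2 + T^2. Otherwise 2 e^2 <= S e for every entry, and the total is at most (P + r)^2
    / 2. *)
Lemma sum_sqr_le (I : finType) (e : I -> nat) (P r : nat) :
  (forall i, e i <= P) -> \sum_i e i <= P + r -> \sum_i e i ^ 2 <= P ^ 2 + r ^ 2.
Proof.
move=> eP eS; set S := \sum_i e i in eS.
have [/existsP[i hi]|/existsPn H] := boolP [exists i, S <= 2 * e i].
  rewrite (bigD1 i) //=; have := sum_sqr_le_sqr_sum (predC1 i) e.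
  have ES : S = e i + \sum_(j | j != i) e j by rewrite /S (bigD1 i).
  rewrite /=; set T := \sum_(j | _) e j in ES *; set U := \sum_(j | _) _ ^ 2.
  move: (eP i) hi; rewrite ES in eS * => aP Ta UT; clear ES; move: (e i) T U =>
    a T U in eS aP Ta UT *.
  have [Tr|rT] := leqP T r.
    by apply: leq_add; [rewrite leq_sqr|apply: leq_trans UT _; rewrite leq_sqr].
  have [c Tc] : exists c, T = r + c by exists (T - r); lia.
  have [b Pb] : exists b, P = a + c + b by exists (P - (a + c)); lia.
  have rc : r * c <= a * c by apply: leq_mul => //; lia.
  apply: (@leq_trans (a ^ 2 + T ^ 2)); first by rewrite leq_add2l.
  rewrite Tc Pb; nia.
have : \sum_i 2 * e i ^ 2 <= \sum_i S * e i.
  apply: leq_sum => i _; have := H i; nia.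
rewrite -!big_distrr /= -/S; have := leq_mul eS eS.
by have := (nat_Cauchy P r).1; clearbody S; nia.
Qed.

(** * Estimates for large n *)

Section Large.
Variable R : realType.
Local Open Scope ring_scope.

Lemma hyp_sqr a b : hyp R a b ^+ 2 = a%:R ^+ 2 + b%:R ^+ 2.
Proof. by rewrite /hyp sqr_sqrtr // natrD !natrX. Qed.

Lemma hyp_le_sqr (a b : nat) (x : R) : 0 <= x ->
  a%:R ^+ 2 + b%:R ^+ 2 <= x ^+ 2 -> hyp R a b <= x.
Proof.
by move=> x0 h; rewrite -(ler_pXn2r (n := 2)) ?nnegrE ?hyp_ge0 // hyp_sqr.
Qed.

Lemma hyp_ge_leg (a b : nat) : a%:R <= hyp R a b.
Proof.
rewrite -(ler_pXn2r (n := 2)) ?nnegrE ?hyp_ge0 // hyp_sqr.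
by rewrite lerDl sqr_ge0.
Qed.

(** For e = deg - 1 the hypotheses say that e is at most [P] with sum at most [P + r], so
    [sum_sqr_le] applies. The coefficients come from (e + 1)(e + 1 - 9/20) = e^2 + 31/20 e + 11/20,
    the constant being raised to 3/4 to include the leaves. *)
Lemma SO_large (G : sgraph) (P r : nat) :
  (forall x : G, 1 <= deg x <= P.+1)%N -> (\sum_(x : G) deg x <= P + r + #|G|)%N ->
  SO R G <= (P%:R ^+ 2 + r%:R ^+ 2 + 31 / 20 * (P%:R + r%:R) + 3 / 4 * #|G|%:R).
Proof.
move=> dP dS; rewrite -(ler_pMn2r (ltn0Sn 1)) SO_double.
(* The value d - 9/20 would be too small at d = 1: on an edge between degrees 1 and 2 it gives 2.1 <
   sqrt 5. *)
pose q (d : nat) : R := if d == 1 then 3 / 4 else d%:R - 9 / 20.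
apply: le_trans (@energy_le R G (hyp R) q _) _.
  have key (a b : nat) : (1 <= a)%N -> (a <= b)%N -> hyp R a b <= q a + q b.
    move=> a1 ab; rewrite /q.
    have A1 : 1 <= a%:R :> R by rewrite ler1n.
    have AB : a%:R <= b%:R :> R by rewrite ler_nat.
    case: eqVneq => [a1'|na]; case: eqVneq => [b1'|nb]; [|..|].
    - by apply: hyp_le_sqr; rewrite ?a1' ?b1'; lra.
    - have B2 : 2 <= b%:R :> R by rewrite (ler_nat _ 2); lia.
      by apply: hyp_le_sqr; rewrite ?a1'; nra.
    - lia.
    - have A2 : 2 <= a%:R :> R by rewrite (ler_nat _ 2); lia.
      by apply: hyp_le_sqr; nra.
  move=> x y _; have /andP[x1 _] := dP x; have /andP[y1 _] := dP y.
  have [xy|yx] := leqP (deg x) (deg y); first exact: key.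
  by rewrite hypC addrC; apply: key; rewrite // ltnW.
rewrite ler_pMn2r //.
pose e (x : G) := (deg x).-1.
have dE x : deg x = (e x).+1 by rewrite /e; have := dP x; lia.
have qe x : q (deg x) *+ deg x <= (e x ^ 2)%:R + 31 / 20 * (e x)%:R + 3 / 4.
  rewrite -mulr_natr dE /q; have e0 : 0 <= (e x)%:R :> R by [].
  case: eqVneq => [[->]|_]; rewrite natrX -natr1; nra.
apply: le_trans (ler_sum _ (fun x _ => qe x)) _.
rewrite !big_split /= sumr_const -mulr_natr -mulr_sumr -!natr_sum.
have eS : (\sum_x e x <= P + r)%N.
  have : (\sum_(x : G) deg x = \sum_(x : G) e x + #|G|)%N.
    rewrite -sum1_card -big_split; apply: eq_bigr => x _.
    by rewrite dE /= addn1.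
  move: dS => /[swap] ->; by rewrite leq_add2r.
have eP x : (e x <= P)%N by have := dP x; rewrite dE; lia.
have := sum_sqr_le eP eS; rewrite -(ler_nat R) natrD !natrX => h2.
by move: eS; rewrite -(ler_nat R) natrD => h1; lra.
Qed.

(* [N] is the degree of the apex of the cone over [G]. *)
Lemma cone_large (G : sgraph) (P r N : nat) : (0 < N)%N ->
  (forall x : G, 1 <= deg x <= P.+1)%N -> (\sum_(x : G) deg x <= P + r + #|G|)%N ->
  let s := P%:R ^+ 2 + r%:R ^+ 2 : R in let d := P%:R + r%:R : R in let g :=
    #|G|%:R : R in
  (\sum_(x : G) hyp R N (deg x).+1) *+ 2 +
    \sum_(x : G) \sum_(y : G) hyp R (deg x).+1 (deg y).+1 *+ adj x y <=
  (g * N%:R + (s + 4 * d + 4 * g) / (2 * N%:R) + s + 5 / 2 * d + 3 / 2 * g) *+ 2.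
Proof.
move=> N0 dP dS; cbv zeta.
set s : R := _ ^+ 2 + _; set d : R := P%:R + r%:R; set g : R := #|G|%:R.
have N0' : 0 < N%:R :> R by rewrite ltr0n.
(* This [q] suffices because (a + 1)^2 + (b + 1)^2 <= (a + b + 1)^2 as soon as 2 a b >= 1. *)
pose q (d : nat) : R := d%:R + 1 / 2.
apply: le_trans (lerD (lexx _) (@energy_le R G (fun a b => hyp R a.+1 b.+1) q _)) _.
  move=> x y _; have /andP[x1 _] := dP x; have /andP[y1 _] := dP y.
  have X1 : 1 <= (deg x)%:R :> R by rewrite ler1n.
  have Y1 : 1 <= (deg y)%:R :> R by rewrite ler1n.
  by apply: hyp_le_sqr; rewrite -?natr1 /q; nra.
rewrite -mulrnDl ler_pMn2r //.
pose e (x : G) := (deg x).-1.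
have dE x : deg x = (e x).+1 by rewrite /e; have := dP x; lia.
have qe x : q (deg x) *+ deg x = (e x ^ 2)%:R + 5 / 2 * (e x)%:R + 3 / 2.
  by rewrite -mulr_natr dE /q natrX -natr1; lra.
(* The first-order bound sqrt (N^2 + t^2) <= N + t^2 / (2 N) with t = e + 2, for the edges to the
   apex. *)
have he x : hyp R N (deg x).+1 <= N%:R + ((e x ^ 2)%:R + 4 * (e x)%:R + 4) / (2 *
  N%:R).
  have e0 : 0 <= (e x)%:R :> R by [].
  apply: hyp_le_sqr.
    by rewrite addr_ge0 ?divr_ge0 ?addr_ge0 ?mulr_ge0.
  rewrite dE -!natr1 natrX.
  set z := _ / _; have -> : N%:R ^+ 2 + (((e x)%:R + 1) + 1) ^+ 2 = N%:R ^+ 2 + 2 *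
    N%:R * z :> R.
    by rewrite /z; field; rewrite gt_eqF.
  by rewrite sqrrD; have := sqr_ge0 z; lra.
have eS : (\sum_x e x <= P + r)%N.
  have : (\sum_(x : G) deg x = \sum_(x : G) e x + #|G|)%N.
    rewrite -sum1_card -big_split; apply: eq_bigr => x _.
    by rewrite dE /= addn1.
  move: dS => /[swap] ->; by rewrite leq_add2r.
have eP x : (e x <= P)%N by have := dP x; rewrite dE; lia.
have := sum_sqr_le eP eS; rewrite -(ler_nat R) natrD !natrX => h2.
move: eS; rewrite -(ler_nat R) natrD => h1.
have S1 : \sum_(x : G) hyp R N (deg x).+1 <= g * N%:R + (s + 4 * d + 4 * g) / (2 *
  N%:R).
  apply: (@le_trans _ _ (\sum_x (N%:R + ((e x ^ 2)%:R + 4 * (e x)%:R + 4) / (2 *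
    N%:R)))).
    by apply: ler_sum => x _; exact: he.
  rewrite big_split /= sumr_const -[_ *+ _]mulr_natl lerD2l -mulr_suml.
  rewrite ler_pM2r ?invr_gt0 ?mulr_gt0 //.
  rewrite !big_split /= sumr_const -[_ *+ #|G|]mulr_natr -mulr_sumr -!natr_sum /s
    /d /g.
  lra.
have S2 : \sum_(x : G) q (deg x) *+ deg x <= s + 5 / 2 * d + 3 / 2 * g.
  rewrite (eq_bigr _ (fun x _ => qe x)) !big_split /= sumr_const.
  rewrite -[_ *+ #|G|]mulr_natr -mulr_sumr -!natr_sum /s /d /g; lra.
lra.
Qed.

End Large.

(** * Graphs of small maximum degree *)

Section DegreeBounds.
Variables (R : realType) (G : sgraph) (m : nat).
Local Open Scope ring_scope.
Local Notation n := (m.+4.+3).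
Local Notation f := (hyp R).

Lemma SO_small (E M : nat) (ds : seq nat) (l : seq (nat * nat * nat)) :
  (3 <= #|G|)%N -> (forall x : G, 1 <= deg x <= M)%N ->
  (\sum_(x : G) deg x <= 2 * E)%N ->
  (forall d, d \in ds -> exists x : G, deg x = d) ->
  edge_check 0 weight0 M ->
  deg_check weight0 (fun=> 0%num) #|G| E M ds (hyp_comb_floor l) ->
  SO R G < hyp_comb R l.
Proof.
move=> G3 dM dE Hds ec dc.
have := @small_bound R G 0 weight0 (fun=> 0%num) (fun=> 0) E M ds l G3 dM dE Hds _
  ec dc.
rewrite big1 // mul0rn add0r => /(_ _) H.
rewrite -(ltr_pMn2r (ltn0Sn 1)) SO_double.
apply: le_lt_trans (H _); last by move=> d; rewrite mulr0.
by apply: ler_sum => x _; apply: ler_sum => y _; rewrite !addn0.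
Qed.

Lemma hyp_ge_legM (c a b : nat) : c%:R * a%:R <= c%:R * f a b.
Proof. by rewrite ler_wpM2l ?hyp_ge_leg. Qed.

Lemma SO_deg_bound1 : #|G| = n -> (forall x : G, 1 <= deg x <= m.+3)%N ->
  (\sum_(x : G) deg x <= 2 * m.+4.+2)%N -> SO R G < phi'' R n 1.
Proof.
move=> cG dM dE; rewrite phi''_1 SO_S''.
have [m5|m5] := ltnP m 5.
  have im : m \in iota 0 5 by rewrite mem_iota.
  have /andP[ec dc] : _ && _ := allP deg_check_S'' m im.
  apply: (@SO_small (m + 6) (m + 3) [::]) => //.
  - by rewrite cG.
  - by move=> x; have := dM x; lia.
  - by apply: leq_trans dE _; lia.
  - by rewrite cG (_ : m.+4.+3 = m + 7)%N //; lia.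
(* Subtracting 1 from every degree leaves entries at most m + 2 with sum at most (m + 2) + 3; hence
   the values of [P] and [r]. *)
have dS : (\sum_(x : G) deg x <= m.+2 + 3 + #|G|)%N by rewrite cG; lia.
apply: le_lt_trans (SO_large R dM dS) _; rewrite cG /S''_comb /hyp_comb /=.
have := hyp_ge_legM m.+3 m.+4 1; have := hyp_ge_leg R m.+4 3;
  have := hyp_ge_leg R 3 1.
have M5 : 5 <= m%:R :> R by rewrite (ler_nat _ 5).
nra.
Qed.

Lemma SO_deg_bound2 : #|G| = n -> (forall x : G, 1 <= deg x <= m.+4)%N ->
  (\sum_(x : G) deg x <= 2 * m.+4.+3)%N -> SO R G < phi_star2 R n.
Proof.
move=> cG dM dE; rewrite phi_star2E SO_Qstar2.
have [m9|m9] := ltnP m 9.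
  have im : m \in iota 0 9 by rewrite mem_iota.
  have /andP[ec dc] : _ && _ := allP deg_check_Qstar2 m im.
  apply: (@SO_small (m + 7) (m + 4) [::]) => //.
  - by rewrite cG.
  - by move=> x; have := dM x; lia.
  - by apply: leq_trans dE _; lia.
  - by rewrite cG (_ : m.+4.+3 = m + 7)%N //; lia.
have dS : (\sum_(x : G) deg x <= m.+3 + 4 + #|G|)%N by rewrite cG; lia.
apply: le_lt_trans (SO_large R dM dS) _; rewrite cG /Qstar2_comb /hyp_comb /=.
have := hyp_ge_legM m.+3 m.+4.+1 1; have := hyp_ge_leg R m.+4.+1 2;
  have := hyp_ge_leg R 2 2.
have M9 : 9 <= m%:R :> R by rewrite (ler_nat _ 9).
nra.
Qed.

Lemma SO_deg_bound3 : #|G| = n -> (forall x : G, 1 <= deg x <= m.+4)%N ->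
  (\sum_(x : G) deg x <= 2 * m.+4.+4)%N -> (exists x : G, deg x = 3) ->
  SO R G < phi'' R n 3.
Proof.
move=> cG dM dE d3; rewrite phi''_3 SO_Q''3.
have [m17|m17] := ltnP m 17.
  have im : m \in iota 0 17 by rewrite mem_iota.
  have /andP[ec dc] : _ && _ := allP deg_check_Q''3 m im.
  apply: (@SO_small (m + 8) (m + 4) [:: 3]) => //.
  - by rewrite cG.
  - by move=> x; have := dM x; lia.
  - by apply: leq_trans dE _; lia.
  - by move=> d; rewrite inE => /eqP ->.
  - by rewrite cG (_ : m.+4.+3 = m + 7)%N //; lia.
have dS : (\sum_(x : G) deg x <= m.+3 + 6 + #|G|)%N by rewrite cG; lia.
apply: le_lt_trans (SO_large R dM dS) _; rewrite cG /Q''3_comb /hyp_comb /=.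
have := hyp_ge_legM m.+2 m.+4.+1 1; have := hyp_ge_leg R m.+4.+1 2;
  have := hyp_ge_leg R m.+4.+1 3.
have := hyp31_ge R; have := hyp33_ge R.
have : 360%:R <= 100%:R * f 3 2 by apply: hyp_ge; lia.
(* With the bounds collected so far the claim reduces to 1.7 m > 28.2, so 17 is the first value of
   [m] that they cover. *)
have M17 : 17 <= m%:R :> R by rewrite (ler_nat _ 17).
nra.
Qed.

Lemma cone_deg_bound : #|G| = m.+4.+2 -> (forall x : G, 1 <= deg x <= m.+2)%N ->
  (\sum_(x : G) deg x <= 2 * m.+4.+1)%N ->
  (\sum_(x : G) hyp R m.+4.+2 (deg x).+1) *+ 2 +
    \sum_(x : G) \sum_(y : G) hyp R (deg x).+1 (deg y).+1 *+ adj x y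
  < phi'' R n m.+4.+2 *+ 2.
Proof.
move=> cG dM dE; rewrite phi''_n SO_cone_S''.
have [m12|m12] := ltnP m 12.
  have im : m \in iota 0 12 by rewrite mem_iota.
  have /andP[ec dc] : _ && _ := allP deg_check_cone_S'' m im.
  have E6 : m.+4.+2 = (m + 6)%N by lia.
  have := @small_bound R G 1 weight1 (fun d => hyp_floor (m + 6) d.+1 + 1)%num
    (fun d => hyp R (m + 6) d.+1) (m + 5) (m + 2) [::] (cone_S''_comb m).
  move=> H; have {}H := H _ _ _ _ _ ec _.
  rewrite E6; apply: le_lt_trans (H _ _ _ _ _ _) => //.
  - by rewrite lerD2l; apply: ler_sum => x _; apply: ler_sum => y _; rewrite !addn1.
  - by rewrite cG.
  - by move=> x; have := dM x; lia.
  - by apply: leq_trans dE _; lia.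
  - by move=> d; rewrite nat_of_add_bin addn1; exact: hyp_floor_ge.
  - by rewrite cG E6.
have dS : (\sum_(x : G) deg x <= m.+1 + 3 + #|G|)%N by rewrite cG; lia.
apply: le_lt_trans (cone_large R (isT : 0 < m.+4.+2)%N dM dS) _.
rewrite ltr_pMn2r // cG /cone_S''_comb /hyp_comb /=.
have := hyp_ge_legM m.+2 m.+4.+2 2; have := hyp_ge_leg R m.+4.+2 2;
  have := hyp_ge_leg R m.+4.+2 4.
have := hyp_ge_legM m.+2 m.+4 2; have := hyp_ge_leg R m.+4 4; have := hyp42_ge R.
have M12 : 12 <= m%:R :> R by rewrite (ler_nat _ 12).
(* The edge from the apex to the centre: m + 5 is the mean of its two degrees, [hyp a b] is at least
   sqrt 2 times the mean of a and b, and 7/5 < sqrt 2. *)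
have : 7 / 5 * (m%:R + 5) <= f m.+4.+2 m.+4.
  rewrite -(ler_pXn2r (n := 2)) ?nnegrE ?hyp_ge0 //; last by lra.
  by rewrite hyp_sqr; nra.
set N : R := m.+4.+2%:R; have N0 : 0 < N by rewrite ltr0n.
(* The numerator is m^2 + 10 m + 50 and [N] is m + 6; clearing denominators leaves 3 m / 2 >= 17,
   which holds from m = 12 on. *)
set x := _ / (2 * _); have : x <= N / 2 - 1 / 4.
  rewrite /x ler_pdivrMr; last by lra.
  by rewrite /N; nra.
rewrite /N; nra.
Qed.

End DegreeBounds.

(** * Trees with a vertex of large degree *)

(** An index [j] past the end of [s] denotes the class: the edge to every vertex outside [s] is then
    required. *)
Fixpoint edges_present (G : sgraph) (x0 : G) (s : seq G) (L : seq (nat * nat)) :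
  Prop :=
  if L is (i, j) :: L' then
    (if j < size s then is_true (adj (nth x0 s i) (nth x0 s j))
     else forall y, y \notin s -> adj (nth x0 s i) y) /\ edges_present x0 s L'
  else True.

Lemma shapedP (G : sgraph) (L : seq (nat * nat)) (s : seq G) (x0 : G) (n e : nat) :
  #|G| = n -> \sum_(x : G) deg x <= 2 * e ->
  wf_edges L (size s) -> uniq s -> edges_present x0 s L ->
  e <= \sum_(p <- L) mult (size s) n p.1 * mult (size s) n p.2 ->
  shaped L (size s) G.
Proof.
move=> <- le1 wfL us eL le2; have le := leq_trans le1 (leq_mul (leqnn 2) le2).
exists s => //; apply: shape_byP => // -[i j] /=.
have : all (fun p => p.1 < p.2 <= size s) L by have /andP[] := wfL.
have idx k (x : G) : k < size s -> index x s = k -> x = nth x0 s k.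
  by move=> lk ik; rewrite -ik nth_index // -index_mem ik.
elim: L eL {wfL le le1 le2} => //= -[a b] L IH [e1 e2] /andP[/= ab aL].
rewrite inE xpair_eqE => /orP[/andP[/eqP-> /eqP->]|ijL]; last exact: IH.
move=> x y ix iy; have lt_a : a < size s by lia.
rewrite (idx _ _ lt_a ix); case: ltnP e1 => [lt_b|ge_b] e1.
  by rewrite (idx _ _ lt_b iy).
by apply: e1; rewrite -index_mem iy -leqNgt.
Qed.

(** * Non-neighbours of a vertex *)

Definition nonadj (G : sgraph) (c : G) : {set G} :=
  [set y | (y != c) && ~~ adj c y].

Lemma card_nonadj (G : sgraph) (c : G) : deg c + #|nonadj c| + 1 = #|G|.
Proof.
have -> : nonadj c = ~: (c |: [set w | adj c w]).
  by apply/setP => y; rewrite !inE negb_or.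
rewrite -(cardsC (c |: [set w | adj c w])) cardsU1 inE adj_irr /deg; lia.
Qed.

Lemma adj_of_nonadj (G : sgraph) (c y : G) : y != c -> y \notin nonadj c -> adj c y.
Proof. by rewrite inE => -> /negPn. Qed.

Lemma nonadjP (G : sgraph) (c y : G) : y \in nonadj c -> y != c /\ adj c y = false.
Proof. by rewrite inE => /andP[-> /negPf]. Qed.

Lemma adj_neq (G : sgraph) (x y : G) : adj x y -> x != y.
Proof. by move=> h; apply: contraTneq h => ->; rewrite adj_irr. Qed.

Section TreeTop.
Variables (T : sgraph) (c : T) (n : nat).
Hypothesis con : connected T.
Hypothesis cT : #|T| = n.
Hypothesis sumT : \sum_(x : T) deg x <= 2 * n.-1.

Lemma tree_top1 : (deg c).+1 = n -> shaped star_edges 1 T.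
Proof.
move=> dc; have := card_nonadj c; rewrite cT => cn.
have n0 : nonadj c = set0 by apply: cards0_eq; lia.
apply: (@shapedP T star_edges [:: c] c _ _ cT sumT) => //=.
  by split=> // y; rewrite inE => yc; apply: adj_of_nonadj; rewrite ?n0 ?inE.
clear -dc; rewrite !big_cons big_nil /mult /=; lia.
Qed.

Lemma tree_top2 : (deg c).+2 = n -> shaped S'_edges 3 T.
Proof.
move=> dc; have := card_nonadj c; rewrite cT => cn.
have /cards1P[z nz] : #|nonadj c| == 1 by lia.
have [zc cz] : z != c /\ adj c z = false by apply: nonadjP; rewrite nz inE.
have [|b zb] := connected_neighbor z con; first by rewrite cT; lia.
have bz := adj_neq zb.
have bc : b != c by apply: contraTneq zb => ->; rewrite adj_sym cz.
have cb : adj c b by apply: adj_of_nonadj; rewrite // nz inE eq_sym.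
apply: (@shapedP T S'_edges [:: c; b; z] c _ _ cT sumT) => //=.
- by rewrite !inE negb_or eq_sym bc eq_sym zc eq_sym bz.
- split=> //; split; first by rewrite adj_sym.
  split=> // y; rewrite !inE !negb_or => /and3P[yc _ yz].
  by apply: adj_of_nonadj; rewrite ?nz ?inE.
clear -dc; rewrite !big_cons big_nil /mult /=; lia.
Qed.

(** Connectedness attaches the two non-neighbours of [c] in one of three ways: both to one neighbour
    of [c], to two different ones, or in a chain. The edges found exhaust the degree sum, so there
    are no others. *)
Lemma tree_top3 : (deg c).+3 = n ->
  [\/ shaped S''_edges 4 T, shaped spider_edges 5 T | shaped broom_edges 4 T].
Proof.
move=> dc; have := card_nonadj c; rewrite cT => cn.
have c2 : #|nonadj c| = 2 by lia.
have /cards2P[x [y [xy nxy]]] : #|nonadj c| == 2 by rewrite c2.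
have [xc cx] : x != c /\ adj c x = false by apply: nonadjP; rewrite nxy !inE eqxx.
have [yc cy] : y != c /\ adj c y = false by apply: nonadjP;
  rewrite nxy !inE eqxx orbT.
have adjc z : z != c -> z != x -> z != y -> adj c z.
  by move=> zc zx zy; apply: adj_of_nonadj; rewrite // nxy !inE negb_or zx zy.
have T1 : 1 < #|T| by rewrite cT; lia.
have broom a w z : a \notin [:: c; w; z] -> w \in nonadj c -> z \in nonadj c ->
  w != z ->
    adj w a -> adj w z -> shaped broom_edges 4 T.
  move=> + wn zn wz wa wz'; rewrite !inE !negb_or => /and3P[ac aw az].
  have [wc _] := nonadjP wn; have [zc _] := nonadjP zn.
  have nwz : nonadj c = [set w; z].
    by apply/esym/eqP; rewrite eqEcard subUset !sub1set wn zn cards2 wz c2.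
  have adjc' t : t != c -> t != w -> t != z -> adj c t.
    by move=> tc tw tz; apply: adj_of_nonadj; rewrite // nwz !inE negb_or tw tz.
  apply: (@shapedP T broom_edges [:: c; a; w; z] c _ _ cT sumT) => //=.
  - by rewrite !inE !negb_or eq_sym ac eq_sym wc eq_sym zc aw az wz.
  - split; first exact: adjc'.
    split; first by rewrite adj_sym.
    split=> //; split=> // t; rewrite !inE !negb_or => /and4P[tc _ tw tz].
    exact: adjc'.
  clear -dc; rewrite !big_cons big_nil /mult /=; lia.
have [xn yn] : x \in nonadj c /\ y \in nonadj c by rewrite nxy !inE !eqxx orbT.
have [axy|naxy] := boolP (adj x y).
  (* Some edge leaves the pair [x], [y]; its end [w] in the pair may be either of them. *)
  have [|w [a [wn an wa]]] := @connected_cut T (nonadj c) x c con xn.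
    by rewrite inE eqxx.
  have ac : a != c.
    by apply: contraTneq wa => ->; rewrite adj_sym; have [_ ->] := nonadjP wn.
  have [ax ay] : a != x /\ a != y by split; apply: contraNneq an => ->.
  apply: Or33; move: wn; rewrite nxy !inE => /orP[] /eqP wE; subst w.
    by apply: (broom a x y) => //; rewrite !inE !negb_or ac ax ay.
  by apply: (broom a y x) => //; rewrite ?[y == x]eq_sym // 1?adj_sym // !inE
    !negb_or ac ax ay.
have [a xa] := connected_neighbor x con T1.
have [b yb] := connected_neighbor y con T1.
have ac : a != c by apply: contraTneq xa => ->; rewrite adj_sym cx.
have bc : b != c by apply: contraTneq yb => ->; rewrite adj_sym cy.
have ax : a != x by rewrite eq_sym adj_neq.
have bY : b != y by rewrite eq_sym adj_neq.
have ay : a != y by apply: contraNneq naxy => <-.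
have bx : b != x by apply: contraNneq naxy => <-; rewrite adj_sym.
have [ab|nab] := eqVneq a b.
  subst b; apply: Or31; apply: (@shapedP T S''_edges [:: c; a; x;
    y] c _ _ cT sumT) => //=.
  - by rewrite !inE !negb_or eq_sym ac eq_sym xc eq_sym yc ax ay xy.
  - split; first exact: adjc.
    split; first by rewrite adj_sym.
    split; first by rewrite adj_sym.
    split=> // t; rewrite !inE !negb_or => /and4P[tc _ tx ty]; exact: adjc.
  clear -dc; rewrite !big_cons big_nil /mult /=; lia.
apply: Or32; apply: (@shapedP T spider_edges [:: c; a; x; b; y] c _ _ cT sumT) =>
  //=.
- rewrite !inE !negb_or eq_sym ac eq_sym xc eq_sym bc eq_sym yc ax nab ay.
  by rewrite eq_sym bx xy bY.
- split; first exact: adjc.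
  split; first by rewrite adj_sym.
  split; first exact: adjc.
  split; first by rewrite adj_sym.
  split=> // t; rewrite !inE !negb_or => /and5P[tc _ tx _ ty]; exact: adjc.
clear -dc; rewrite !big_cons big_nil /mult /=; lia.
Qed.

End TreeTop.

(** * Quasi-trees with a vertex of large degree *)

Lemma card_other_neighbors (G : sgraph) (u c : G) : adj u c ->
  #|[set w | adj u w] :\ c| = (deg u).-1.
Proof. by move=> uc; rewrite /deg (cardsD1 c [set w | adj u w]) inE uc. Qed.

Section HighDegree.
Variables (G : sgraph) (u c : G) (n : nat).
Hypotheses (cG : #|G| = n) (n7 : 7 <= n).
Hypothesis conT : connected (del_vertex u).
Hypotheses (cu : c != u) (dc : n <= (deg c).+2).

Let nonadj_le1 : #|nonadj c| <= 1.
Proof. by have := card_nonadj c; rewrite cG; move: dc; lia. Qed.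

Let adj_nonadj y : y != c -> y \notin nonadj c -> adj c y.
Proof. exact: adj_of_nonadj. Qed.

Lemma del_neighbor z : z != u -> exists2 b, adj z b & b != u.
Proof.
move=> zu; have cT : 1 < #|del_vertex u| by rewrite card_del cG; move: n7; lia.
have [b zb] := connected_neighbor (Sub z zu : del_vertex u) conT cT.
by exists (val b); [exact: zb | exact: valP b].
Qed.

(** By the degree bound [c] misses at most one vertex: none, [u], or some [z] other than [u]. In the
    last case connectedness of G - u provides the neighbour [b] of [z]. *)
Lemma nonadj_cases :
  [\/ forall y, y != c -> adj c y,
      adj c u = false /\ forall y, y != c -> y != u -> adj c y
    | exists z b, [/\ uniq [:: c; b; z; u], adj c z = false, adj z b &
        forall y, y != c -> y != z -> adj c y]].
Proof.
have [n0|[z nz]] : nonadj c = set0 \/ exists z, nonadj c = [set z].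
  case: (posnP #|nonadj c|) => [/cards0_eq|pos]; first by left.
  by right; apply/cards1P; rewrite eqn_leq nonadj_le1.
- by apply: Or31 => y yc; apply: adj_nonadj; rewrite // n0 inE.
have [zc cz] : z != c /\ adj c z = false by apply: nonadjP; rewrite nz inE.
have adjc y : y != c -> y != z -> adj c y.
  by move=> yc yz; apply: adj_nonadj; rewrite // nz inE.
have [zu|zu] := eqVneq z u; first by subst z; apply: Or32.
have [b zb bu] := del_neighbor zu.
apply: Or33; exists z, b; split=> //.
have bc : b != c by apply: contraTneq zb => ->; rewrite adj_sym cz.
by rewrite /= !inE !negb_or eq_sym bc eq_sym zc cu eq_sym (adj_neq zb) bu zu.
Qed.

Lemma shaped2 : \sum_(x : G) deg x <= 2 * n -> deg u = 2 ->
  [\/ shaped Q2_edges 3 G, shaped Q'2_edges 4 G, shaped Qstar2_edges 4 G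
    | shaped triangle_tail_edges 5 G].
Proof.
move=> sumG du.
have [adjc|[cu' adjc]|[z [b [us cz zb adjc]]]] := nonadj_cases.
- have ucA : adj u c by rewrite adj_sym adjc // eq_sym.
  have : #|[set w | adj u w] :\ c| == 1 by rewrite card_other_neighbors // du.
  case/cards1P => a /setP/(_ a); rewrite !inE eqxx => /andP[ac ua].
  apply: Or41; apply: (@shapedP G Q2_edges [:: c; u; a] c _ _ cG sumG) => //=.
  + by rewrite !inE negb_or cu eq_sym ac (adj_neq ua).
  + do 3! [split; [by rewrite // adjc // eq_sym|]].
    by split=> // y; rewrite !inE !negb_or => /and3P[yc _ _]; exact: adjc.
  by clear -n7; rewrite !big_cons big_nil /mult /=; lia.
- have /cards2P[a [b [ab /setP E]]]
  : #|[set w | adj u w]| == 2 by rewrite -/(deg u) du.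
  have ua : adj u a by have := E a; rewrite !inE eqxx.
  have ub : adj u b by have := E b; rewrite !inE eqxx orbT.
  have ac : a != c by apply: contraTneq ua => ->; rewrite adj_sym cu'.
  have bc : b != c by apply: contraTneq ub => ->; rewrite adj_sym cu'.
  have au : a != u by rewrite eq_sym adj_neq.
  have bu : b != u by rewrite eq_sym adj_neq.
  apply: Or43; apply: (@shapedP G Qstar2_edges [:: c; u; a; b] c _ _ cG sumG) =>
    //=.
  + by rewrite !inE !negb_or cu eq_sym ac eq_sym bc eq_sym au eq_sym bu ab.
  + do 4! [split; [by apply: adjc || done|]].
    by split=> // y; rewrite !inE !negb_or => /and4P[yc yu _ _]; exact: adjc.
  by clear -n7; rewrite !big_cons big_nil /mult /=; lia.
have := us; rewrite /= !inE !negb_or => /and4P[/and3P[cb c_z _] /andP[bz bu] zu _].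
have ucA : adj u c by rewrite adj_sym adjc // eq_sym.
have bcA : adj c b by rewrite adjc // eq_sym.
have : #|[set w | adj u w] :\ c| == 1 by rewrite card_other_neighbors // du.
case/cards1P => a /setP/(_ a); rewrite !inE eqxx => /andP[ac ua].
have [ab|ab] := eqVneq a b.
  subst a; apply: Or42; apply: (@shapedP G Q'2_edges [:: c; b; z;
    u] c _ _ cG sumG) => //=.
  + do 4! [split; [by rewrite // adj_sym|]].
    by split=> // y; rewrite !inE !negb_or => /and4P[yc _ yz _]; exact: adjc.
  by clear -n7; rewrite !big_cons big_nil /mult /=; lia.
have [az|az] := eqVneq a z.
  (* Here [z] and [c] share the neighbours [b] and [u], so [z] takes the part of the vertex added to
     the star and [u] that of a leaf. *)
  subst a; apply: Or43; apply: (@shapedP G Qstar2_edges [:: c; z; b;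
    u] c _ _ cG sumG) => //=.
  + by rewrite !inE !negb_or c_z cb cu eq_sym bz zu bu.
  + do 4! [split; [by rewrite // adj_sym|]].
    by split=> // y; rewrite !inE !negb_or => /and4P[yc yz _ _]; exact: adjc.
  by clear -n7; rewrite !big_cons big_nil /mult /=; lia.
have au : a != u by rewrite eq_sym adj_neq.
have acA : adj c a by exact: adjc.
apply: Or44; apply: (@shapedP G triangle_tail_edges [:: c; b; z; u;
  a] c _ _ cG sumG) => //=.
- by rewrite !inE !negb_or cb c_z cu eq_sym ac bz bu eq_sym ab zu eq_sym az eq_sym
  au.
- do 5! [split; [by rewrite // adj_sym|]].
  by split=> // y; rewrite !inE !negb_or => /and5P[yc _ yz _ _]; exact: adjc.
by clear -n7; rewrite !big_cons big_nil /mult /=; lia.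
Qed.

(** If [c] misses some [z] other than [u], then [z] hangs on a neighbour [b] of [c], and [u] is
    adjacent to [c] and two more vertices. If these are [b] and [z], the graph is Q'_{n,3}; with [b]
    alone among them it is Q''_{n,3}, with [z] alone the house, with neither the diamond with a
    tail. *)
Lemma shaped3 : \sum_(x : G) deg x <= 2 * n.+1 -> deg u = 3 ->
  [\/ shaped Q3_edges 4 G, shaped Q'3_edges 4 G | shaped Q''3_edges 5 G] \/
  [\/ shaped Qstar3_edges 5 G, shaped house_edges 5 G | shaped diamond_tail_edges 6
    G].
Proof.
move=> sumG du.
have others v : adj u v -> exists a b, [/\ a != b, a != v, b != v, adj u a &
  adj u b].
  move=> uv; have : #|[set w | adj u w]
    :\ v| == 2 by rewrite card_other_neighbors // du.
  case/cards2P => a [b [ab /setP E]]; exists a, b; move: (E a) (E b).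
  by rewrite !inE !eqxx orbT => /andP[-> ->] /andP[-> ->].
have [adjc|[cu' adjc]|[z [b [us cz zb adjc]]]] := nonadj_cases.
- have ucA : adj u c by rewrite adj_sym adjc // eq_sym.
  have [a [b [ab ac bc ua ub]]] := others c ucA; left.
  apply: Or31; apply: (@shapedP G Q3_edges [:: c; u; a; b] c _ _ cG sumG) => //=.
  + by rewrite !inE !negb_or cu eq_sym ac eq_sym bc (adj_neq ua) (adj_neq ub) ab.
  + do 5! [split; [by rewrite // adjc // eq_sym|]].
    by split=> // y; rewrite !inE !negb_or => /and4P[yc _ _ _]; exact: adjc.
  by clear -n7; rewrite !big_cons big_nil /mult /=; lia.
- have [d ud] : exists d, adj u d.
    have /card_gt0P[d] : 0 < #|[set w | adj u w]| by rewrite -/(deg u) du.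
    by rewrite inE => ud; exists d.
  have [a [b [ab ad bd ua ub]]] := others d ud.
  have nc x : adj u x -> x != c by move=> h; apply: contraTneq h => ->;
    rewrite adj_sym cu'.
  have nu x : adj u x -> x != u by move=> h; rewrite eq_sym adj_neq.
  right; apply: Or31; apply: (@shapedP G Qstar3_edges [:: c; u; a; b;
    d] c _ _ cG sumG) => //=.
  + rewrite !inE !negb_or cu ![c == _]eq_sym !nc //.
    by rewrite (adj_neq ua) (adj_neq ub) (adj_neq ud) ab ad bd.
  + do 6! [split; [by rewrite // adjc ?nc ?nu|]].
    by split=> // y; rewrite !inE !negb_or => /and5P[yc yu _ _ _]; exact: adjc.
  by clear -n7; rewrite !big_cons big_nil /mult /=; lia.
have := us; rewrite /= !inE !negb_or => /and4P[/and3P[cb c_z _] /andP[bz bu] zu _].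
have ucA : adj u c by rewrite adj_sym adjc // eq_sym.
have bcA : adj c b by rewrite adjc // eq_sym.
have Q'_case : adj u b -> adj u z -> shaped Q'3_edges 4 G.
  move=> ub uz; apply: (@shapedP G Q'3_edges [:: c; b; z; u] c _ _ cG sumG) => //=.
  + do 5! [split; [by rewrite // adj_sym|]].
    by split=> // y; rewrite !inE !negb_or => /and4P[yc _ yz _]; exact: adjc.
  by clear -n7; rewrite !big_cons big_nil /mult /=; lia.
have Q''_case a : adj u b -> adj u a -> uniq [:: c; b; z; u; a] ->
  shaped Q''3_edges 5 G.
  move=> ub ua us'; apply: (@shapedP G Q''3_edges [:: c; b; z; u;
    a] c _ _ cG sumG) => //.
  + move: us'; rewrite /= !inE !negb_or => /and4P[/and4P[_ _ _ ca] _ /andP[_ za] _].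
    do 6! [split; [by rewrite // ?adjc // 1?eq_sym // adj_sym|]].
    by split=> // y; rewrite !inE !negb_or => /and5P[yc _ yz _ _]; exact: adjc.
  by clear -n7; rewrite !big_cons big_nil /mult /=; lia.
have house_case a : adj u z -> adj u a -> uniq [:: c; b; z; u; a] ->
  shaped house_edges 5 G.
  move=> uz ua us'; apply: (@shapedP G house_edges [:: c; b; z; u;
    a] c _ _ cG sumG) => //.
  + move: us'; rewrite /= !inE !negb_or => /and4P[/and4P[_ _ _ ca] _ /andP[_ za] _].
    do 6! [split; [by rewrite // ?adjc // 1?eq_sym // adj_sym|]].
    by split=> // y; rewrite !inE !negb_or => /and5P[yc _ yz _ _]; exact: adjc.
  by clear -n7; rewrite !big_cons big_nil /mult /=; lia.
have [a [a' [aa' ac a'c ua ua']]] := others c ucA.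
have us5 x : adj u x -> x != c -> x != b -> x != z -> uniq [:: c; b; z; u; x].
  move=> ux xc xb xz; have := us; rewrite /= !inE !negb_or => /and4P[/and3P[-> ->
    ->] /andP[-> ->] -> _].
  by rewrite !(eq_sym _ x) xc xb xz (eq_sym x) (adj_neq ux).
have [ab|ab] := eqVneq a b.
  subst a; have [a'z|a'z] := eqVneq a' z.
    by subst a'; left; apply: Or32; apply: Q'_case.
  by left; apply: Or33; apply: (Q''_case a') => //; apply: us5; rewrite // eq_sym.
have [a'b|a'b] := eqVneq a' b.
  subst a'; have [az|az] := eqVneq a z.
    by subst a; left; apply: Or32; apply: Q'_case.
  by left; apply: Or33; apply: (Q''_case a) => //; apply: us5.
right; have [az|az] := eqVneq a z.
  by subst a; apply: Or32; apply: (house_case a') => //; apply: us5;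
    rewrite // eq_sym.
have [a'z|a'z] := eqVneq a' z.
  by subst a'; apply: Or32; apply: (house_case a) => //; apply: us5.
apply: Or33; apply: (@shapedP G diamond_tail_edges [:: c; b; z; u; a;
  a'] c _ _ cG sumG) => //.
- have := us5 a ua ac ab az; have := us5 a' ua' a'c a'b a'z.
  rewrite /= !inE !negb_or => /and5P[/and4P[_ _ _ ->] /and3P[_ _ ->] /andP[_ ->] ->
    _].
  by move=> /and5P[/and4P[-> -> -> ->] /and3P[-> -> ->] /andP[-> ->] -> _];
    rewrite aa'.
- do 7! [split; [by rewrite /= // ?adjc // 1?eq_sym // adj_sym|]].
  split=> // y; rewrite !inE !negb_or => /and5P[yc _ yz _ _]; exact: adjc.
by clear -n7; rewrite !big_cons big_nil /mult /=; lia.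
Qed.

End HighDegree.

(** * The theorem *)

Lemma mem_cone L r i j : ((i, j) \in cone L r) =
  match i, j with
  | 0, j'.+1 => j' <= r
  | i'.+1, j'.+1 => (i', j') \in L
  | _, 0 => false
  end.
Proof.
rewrite mem_cat; apply/orP/idP => [[/mapP[k]|/mapP[[a b] ab]]|].
- by rewrite mem_iota ltnS => /andP[_ kr] [-> ->].
- by move=> [-> ->].
case: i => [|i]; case: j => [|j] // h.
  by left; apply/mapP; exists j => //; rewrite mem_iota ltnS.
by right; apply/mapP; exists (i, j).
Qed.

Lemma shaped_cone L r (G : sgraph) (u : G) : (forall v, v != u -> adj u v) ->
  shaped L r (del_vertex u) -> shaped (cone L r) r.+1 G.
Proof.
move=> adju [s ss [us sa]]; exists (u :: map val s);
  first by rewrite /= size_map ss.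
split=> [|x y].
  rewrite /= (map_inj_uniq val_inj) us andbT.
  by apply/mapP => -[x _ xu]; move/eqP: (valP x); apply; exact: esym xu.
have idx (x' : del_vertex u) : index (val x') (u :: map val s) = (index x' s).+1.
  by rewrite /= eq_sym (negPf (valP x')) (index_map val_inj).
have idu : index u (u :: map val s) = 0 by rewrite /= eqxx.
have le (x' : del_vertex u) : index x' s <= r by rewrite -ss index_size.
have [->|xu] := eqVneq x u; have [->|yu] := eqVneq y u.
- by rewrite adj_irr idu /edge_rel mem_cone.
- by rewrite adju // idu (idx (Sub y yu)) /edge_rel !mem_cone le.
- by rewrite adj_sym adju // idu (idx (Sub x xu)) /edge_rel !mem_cone le.
by rewrite (idx (Sub x xu)) (idx (Sub y yu)) /edge_rel !mem_cone;
  exact: (sa (Sub x xu) (Sub y yu)).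
Qed.

Lemma adj_of_full_degree (G : sgraph) (u : G) : (deg u).+1 = #|G| ->
  forall v, v != u -> adj u v.
Proof.
move=> du v vu; apply: adj_of_nonadj => //.
have -> : nonadj u = set0 by apply: cards0_eq; have := card_nonadj u; lia.
by rewrite inE.
Qed.

(** Splits off the edges at [u]; every other vertex is adjacent to [u], so its degree in G is one
    more than in G - u. *)
Lemma SO_cone (R : realType) (G : sgraph) (u : G) : (deg u).+1 = #|G| ->
  (SO R G *+ 2 = (\sum_(x : del_vertex u) hyp R (deg u) (deg x).+1) *+ 2 +
   \sum_(x : del_vertex u) \sum_(y : del_vertex u)
     hyp R (deg x).+1 (deg y).+1 *+ adj x y)%R.
Proof.
move=> du; have adju := adj_of_full_degree du.
have dE (x : del_vertex u) : deg (val x) = (deg x).+1.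
  by rewrite deg_del adju ?(valP x).
rewrite SO_double (big_del u) mulr2n -addrA; congr (_ + _)%R.
  rewrite (big_del u) adj_irr mulr0n add0r; apply: eq_bigr => x _.
  by rewrite dE adju ?(valP x).
rewrite -big_split; apply: eq_bigr => x _ /=.
rewrite (big_del u) dE adj_sym adju ?(valP x) // mulr1n hypC; congr (_ + _)%R.
by apply: eq_bigr => y _; rewrite dE.
Qed.

Lemma shaped_SO (R : realType) (G : sgraph) L r n : wf_edges L r -> #|G| = n ->
  shaped L r G -> SO R G = shape_SO R L r n.
Proof. by move=> wfL <- [s ss sh]; subst r; exact: shape_by_SO wfL R sh. Qed.

Lemma extremal_shape (R : realType) (G H : sgraph) (L : seq (nat * nat)) (r n :
  nat) (phi : R) :
  #|G| = n -> #|H| = n -> wf_edges L r -> phi = shape_SO R L r n ->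
  shaped L r H -> shaped L r G \/ (SO R G < phi)%R ->
  (SO R G <= phi)%R /\ (SO R G = phi <-> iso G H).
Proof.
move=> cG cH wfL -> shH.
have SOE : shaped L r G -> SO R G = shape_SO R L r n by exact: shaped_SO.
case=> [shG|lt].
  by rewrite SOE //; split=> //; split=> // _; apply: shape_iso shG shH;
    rewrite cG cH.
split; first exact: ltW.
split=> [e|/iso_shape/(_ shH)/SOE//]; by rewrite e ltxx in lt.
Qed.

Section Cases.
Variables (R : realType) (m : nat) (G : sgraph).
Local Notation n := m.+4.+3.

Lemma QT1_cases : QT n 1 G -> ~ iso G (Q n 1) -> ~ iso G (Q' n 1) ->
  shaped S''_edges 4 G \/ (SO R G < phi'' R n 1)%R.
Proof.
move=> /QT_facts[] // con cG sumG _ nQ nQ'.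
have d1 (x : G) : 0 < deg x by apply: connected_deg_gt0; rewrite ?cG.
(* For k = 1 this is the degree sum of a tree on n vertices, so the classification of trees applies
   to G itself. *)
have sumG' : \sum_(x : G) deg x <= 2 * n.-1.
  by apply: leq_trans sumG _; lia.
have [[c dc]|H] : (exists c : G, m.+4 <= deg c) \/ forall x : G, deg x <= m.+3.
  have [/existsP[c dc]|/existsPn H] := boolP [exists c : G, m.+4 <= deg c].
    by left; exists c.
  by right=> x; rewrite -ltnS ltnNge H.
  have := card_nonadj c; rewrite cG => cn.
  have [e|[e|e]] : (deg c).+1 = n \/ (deg c).+2 = n \/ (deg c).+3 = n by lia.
  - case: nQ; apply: (shape_iso _ (tree_top1 cG sumG' e) (shape_Q1 m)).
    by rewrite cG card_option card_ord.
  - case: nQ'; apply: (shape_iso _ (tree_top2 con cG sumG' e) (shape_Q'1 m)).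
    by rewrite cG card_option card_ord.
  have [sh|sh|sh] := tree_top3 con cG sumG' e; [by left| |]; right.
    by rewrite (shaped_SO R _ cG sh) // spider_lt.
  by rewrite (shaped_SO R _ cG sh) // broom_lt.
right; apply: SO_deg_bound1 => // x; by rewrite d1 H.
Qed.

Lemma QTn_cases : QT n m.+4.+2 G -> ~ iso G (Q n m.+4.+2) ->
  ~ iso G (Q' n m.+4.+2) ->
  shaped (cone S''_edges 4) 5 G \/ (SO R G < phi'' R n m.+4.+2)%R.
Proof.
move=> /QT_facts[] // con cG _ [u [du conT sumT]] nQ nQ'.
have du' : (deg u).+1 = #|G| by rewrite cG du.
have adju := adj_of_full_degree du'.
have cT : #|del_vertex u| = m.+4.+2 by rewrite card_del cG.
have d1 (x : del_vertex u) : 0 < deg x by apply: connected_deg_gt0; rewrite ?cT.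
have sumT' : \sum_(x : del_vertex u) deg x <= 2 * m.+4.+2.-1.
  by apply: leq_trans sumT _; lia.
have [[c dc]|H] : (exists c : del_vertex u,
  m.+3 <= deg c) \/ forall x : del_vertex u, deg x <= m.+2.
  have [/existsP[c dc]|/existsPn H] := boolP [exists c : del_vertex u,
    m.+3 <= deg c].
    by left; exists c.
  by right=> x; rewrite -ltnS ltnNge H.
  have := card_nonadj c; rewrite cT => cn.
  have [e|[e|e]] : (deg c).+1 = m.+4.+2 \/ (deg c).+2 = m.+4.+2 \/ (deg c).+3 =
    m.+4.+2 by lia.
  - case: nQ; apply: (shape_iso _ (shaped_cone adju (tree_top1 cT sumT' e))
    (shape_Qn m)).
    by rewrite cG card_option card_ord.
  - case: nQ'; apply: (shape_iso _ (shaped_cone adju (tree_top2 conT cT sumT' e))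
    (shape_Q'n m)).
    by rewrite cG !card_option card_ord.
  have [/(shaped_cone adju) sh|/(shaped_cone adju) sh|/(shaped_cone adju) sh]
    := tree_top3 conT cT sumT' e; [by left| |]; right.
    by rewrite (shaped_SO R _ cG sh) // cone_spider_lt.
  by rewrite (shaped_SO R _ cG sh) // cone_broom_lt.
right; rewrite -(ltr_pMn2r (ltn0Sn 1)) (SO_cone R du') du.
by apply: cone_deg_bound => // x; rewrite d1 H.
Qed.

Lemma QT_high_degree (k : nat) : k <= 3 -> QT n k G ->
  exists u : G, [/\ deg u = k, connected (del_vertex u) &
  (exists2 c : G, c != u & n <= (deg c).+2) \/ forall x : G, deg x <= m.+4].
Proof.
move=> k3 /QT_facts[] // con cG _ [u [du conT _]]; exists u; split=> //.
have [/existsP[c dc]|/existsPn H] := boolP [exists c : G, m.+4.+1 <= deg c].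
  (* The degree of [u] is at most 3, too small for [c]. *)
  by left; exists c => //; apply: contraTneq dc => ->; rewrite du; lia.
by right=> x; rewrite -ltnS ltnNge H.
Qed.

Lemma QT2_cases : QT n 2 G -> ~ iso G (Q n 2) -> ~ iso G (Q' n 2) ->
  shaped Qstar2_edges 4 G \/ (SO R G < phi_star2 R n)%R.
Proof.
move=> qt nQ nQ'; have [|u [du conT hd]] := QT_high_degree _ qt; first by [].
have [//|con cG sumG _] := QT_facts _ qt.
have d1 (x : G) : 0 < deg x by apply: connected_deg_gt0; rewrite ?cG.
have sumG' : \sum_(x : G) deg x <= 2 * n by apply: leq_trans sumG _; lia.
case: hd => [[c cu dc]|H]; last first.
  by right; apply: SO_deg_bound2 => // x; rewrite d1 H.
have [sh|sh|sh|sh] := shaped2 cG isT conT cu dc sumG' du.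
- by case: nQ; apply: (shape_iso _ sh (shape_Q2 m));
  rewrite cG card_option card_ord.
- by case: nQ'; apply: (shape_iso _ sh (shape_Q'2 m));
  rewrite cG !card_option card_ord.
- by left.
by right; rewrite (shaped_SO R _ cG sh) // triangle_tail_lt.
Qed.

Lemma QT3_cases : QT n 3 G -> ~ iso G (Q n 3) -> ~ iso G (Q' n 3) ->
  shaped Q''3_edges 5 G \/ (SO R G < phi'' R n 3)%R.
Proof.
move=> qt nQ nQ'; have [|u [du conT hd]] := QT_high_degree _ qt; first by [].
have [//|con cG sumG _] := QT_facts _ qt.
have d1 (x : G) : 0 < deg x by apply: connected_deg_gt0; rewrite ?cG.
have sumG' : \sum_(x : G) deg x <= 2 * n.+1 by apply: leq_trans sumG _; lia.
case: hd => [[c cu dc]|H]; last first.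
  by right; apply: SO_deg_bound3 => // [x|]; [rewrite d1 H|exists u].
have [[sh|sh|sh]|[sh|sh|sh]] := shaped3 cG isT conT cu dc sumG' du.
- by case: nQ; apply: (shape_iso _ sh (shape_Q3 m));
  rewrite cG card_option card_ord.
- by case: nQ'; apply: (shape_iso _ sh (shape_Q'3 m));
  rewrite cG !card_option card_ord.
- by left.
- by right; rewrite (shaped_SO R _ cG sh) // Qstar3_lt.
- by right; rewrite (shaped_SO R _ cG sh) // house_lt.
by right; rewrite (shaped_SO R _ cG sh) // diamond_tail_lt.
Qed.

End Cases.

Theorem theorem3p4 (R : realType) (n k : nat) (G : sgraph)
    (hn : 7 <= n) (hk : k \in [:: 1; 2; 3; n.-1])
    (hG : QT n k G) (hQ : ~ iso G (Q n k)) (hQ' : ~ iso G (Q' n k)) :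
  (k \in [:: 1; 3; n.-1] ->
     (SO R G <= phi'' R n k)%R /\
     (SO R G = phi'' R n k <-> iso G (Q'' n k))) /\
  (k = 2 ->
     (SO R G <= phi_star2 R n)%R /\
     (SO R G = phi_star2 R n <-> iso G (Qstar n 2))).
Proof.
have [m nE] : exists m, n = m.+4.+3 by exists (n - 7); lia.
subst n; have cG : #|G| = m.+4.+3 by case: hG.
split=> [|k2]; last first.
  subst k; apply: (extremal_shape cG _ (isT : wf_edges Qstar2_edges 4) _
    (shape_Qstar2 m)).
  - by rewrite card_option card_ord.
  - exact: phi_star2E.
  exact: QT2_cases.
rewrite !inE => /or3P[] /eqP kE; subst k.
- apply: (extremal_shape cG _ (isT : wf_edges S''_edges 4) (phi''_1 R m)
  (shape_Q''1 m)).
    by rewrite !card_option card_ord.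
  exact: QT1_cases.
- apply: (extremal_shape cG _ (isT : wf_edges Q''3_edges 5) (phi''_3 R m)
  (shape_Q''3 m)).
    by rewrite !card_option card_ord.
  exact: QT3_cases.
apply: (extremal_shape cG _ (isT : wf_edges (cone S''_edges 4) 5) (phi''_n R m)
  (shape_Q''n m)).
  by rewrite !card_option card_ord.
exact: QTn_cases.
Qed.
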